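(* Let $n,K\ge1$ be integers with $K\le n-1$, let $a>0$ be the constant fixed in the context, and let $\Upsilon$ (the admissible set) and $\mu_{n,K}^{(d_i),M}$ be as in the context. For every $((d_i),M)\in\Upsilon$, $$\mathrm{d}_{\mathrm{TV}}\left(\mu_{n,K}^{(d_i),M},\mu_G\right)^2\le(\log 2\pi-1)\frac{2^{15}}{a^8n(K+1)},$$ where $\mu_G$ is the standard Gaussian distribution on $\mathbf{R}$ and $\mathrm{d}_{\mathrm{TV}}(\mu,\nu)=\sup_B|\mu(B)-\nu(B)|$ over Borel sets $B\subset\mathbf{R}$. Consequently, there exist a probability measure $\mathbf{Q}$ and random variables $U,Z$ on some space such that under $\mathbf{Q}$, $U$ has distribution $\mu_{n,K}^{(d_i),M}$, $Z$ is a standard Gaussian, and $$\mathbf{Q}(U\ne Z)\le\sqrt{(\log2\pi-1)\frac{2^{15}}{a^8n(K+1)}}.$$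
   Context: Constant $a$. With $(t_e)$ i.i.d. mean-$1$ exponential weights on the nearest-neighbor edges of $\mathbb{Z}^2$ and $T(\gamma)=\sum_{e\in\gamma}t_e$, fix $a,c'>0$ such that for all $k\ge1$, $\mathbf{P}(\exists$ vertex self-avoiding path $\gamma$ from $0$ with $\#\gamma\ge k$ edges but $T(\gamma)\le ak)\le e^{-c'k}$ (such constants exist by Kesten's lemma). Admissible set. $\Upsilon$ is the set of pairs $((d_i)_{i\ge1},M)$ with $d_i\in\mathbf{N}$, $M\in\mathbf{N}$ such that (1) $anK/2\le M\le n(K+1)$; (2) $d_i\ge K+1$ for all $i$; (3) $\#\{i=1,\dots,M:d_i\le4K/a\}\ge aM/2$. Growth process. Let $\mathsf{C}_{n,K}=[0,n]\times[0,K]$ (lattice points understood). Let $\mathcal{C}_0$ be the set of $x\in\mathsf{C}_{n,K}$ with first coordinate $0$. For a subset $\mathcal{C}_i$ let $\mathcal{B}_i$ be the set of nearest-neighbor edges with one endpoint in $\mathcal{C}_i$ and the other in $\mathsf{C}_{n,K}\setminus\mathcal{C}_i$. Inductively, choose an edge $e_{i+1}=\{x_{i+1},y_{i+1}\}$ uniformly from $\mathcal{B}_i$, with $x_{i+1}\in\mathcal{C}_i$, and set $\mathcal{C}_{i+1}=\mathcal{C}_i\cup\{y_{i+1}\}$. Let $b_i=\#\mathcal{B}_{i-1}$ and let $\mathcal{N}$ be the smallest $i$ such that $y_i$ has first coordinate $n$. Given the growth, let $X_1,\dots,X_{\mathcal{N}}$ be independent exponential random variables with $\mathbf{E}X_i=b_i^{-1}$.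 $\mu_{n,K}^{(d_i),M}$ is the conditional distribution of $$\frac{\sum_{i=1}^{\mathcal{N}}(X_i-b_i^{-1})}{\sqrt{\sum_{i=1}^{\mathcal{N}}b_i^{-2}}}$$ given $(b_i)=(d_i)$ and $\mathcal{N}=M$; that is, it is the law of $\left(\sum_{i=1}^Md_i^{-1}(Y_i-1)\right)\big/\sqrt{\sum_{i=1}^Md_i^{-2}}$ where $Y_1,\dots,Y_M$ are i.i.d. exponential with mean $1$. *)

(* Defs.v *)
From HB Require Import structures.
From mathcomp Require Import all_boot all_order all_algebra finmap.
From mathcomp Require Import all_classical all_reals all_analysis.
From mathcomp Require Import measurable_realfun.

Set Implicit Arguments.
Unset Strict Implicit.
Unset Printing Implicit Defensive.

Import Order.TTheory GRing.Theory Num.Theory.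
Import numFieldNormedType.Exports.

Local Open Scope classical_set_scope.
Local Open Scope ring_scope.

(* Laws are compared on measurable sets only: the library's measures are total
   functions with junk values elsewhere. *)
Definition has_law d (T : measurableType d) (R : realType)
    (P : probability T R) (X : {RV P >-> R})
    (mu : probability (measurableTypeR R) R) : Prop :=
  forall B : set R, measurable B -> distribution P X B = mu B.

Definition mutually_independent d (T : measurableType d) (R : realType)
    (P : probability T R) (I : choiceType) (E : set I)
    (X : I -> {RV P >-> R}) : Prop :=
  forall (J : {fset I}) (B : I -> set R),
    [set` J] `<=` E -> (forall i, measurable (B i)) ->
    P (\bigcap_(i in [set` J]) (X i @^-1` B i)) =
    (\prod_(i <- J) P (X i @^-1` B i))%E.

Definition dTV (R : realType) (mu nu : probability (measurableTypeR R) R) : R :=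
  sup [set `|fine (mu B) - fine (nu B)| | B in measurable].

Definition gaussian (R : realType) : probability (measurableTypeR R) R :=
  normal_prob 0 1.

(* The exponential distribution with rate 1, hence with mean 1. *)
Definition exponential1 (R : realType) : probability (measurableTypeR R) R.
Proof.
unshelve refine (exponential_prob 1 : probability (measurableTypeR R) R).
exact: ltr01.
Defined.

Section iid_law.
Context d (T : measurableType d) (R : realType).

Definition cons_pair n (x : T * n.-tuple T) : n.+1.-tuple T :=
  [tuple of x.1 :: x.2].

Lemma measurable_cons_pair n : measurable_fun [set: T * n.-tuple T] (@cons_pair n).
Proof. exact: measurable_cons. Qed.

HB.instance Definition _ n :=
  isMeasurableFun.Build _ _ _ _ (@cons_pair n) (@measurable_cons_pair n).

(* The n-fold product of mu, i.e. the law of n i.i.d. variables of law mu; see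
   iid_law_box. *)
Fixpoint iid_law (mu : probability T R) n : probability (n.-tuple T) R :=
  if n is m.+1 then distribution (mu \x iid_law mu m)%E (@cons_pair m)
  else dirac [tuple].

Lemma iid_law_box (mu : probability T R) n (B : 'I_n -> set T) :
  (forall i, measurable (B i)) ->
  iid_law mu n [set y | forall i, B i (tnth y i)] = (\prod_(i < n) mu (B i))%E.
Proof.
elim: n B => [|n IHn] B mB /=.
  rewrite big_ord0 diracE mem_set//=; by case.
rewrite big_ord_recl -IHn//.
rewrite /distribution /pushforward.
rewrite (_ : _ @^-1` _ =
    B ord0 `*` [set y | forall i, B (lift ord0 i) (tnth y i)]); last first.
  apply/seteqP; split => -[x y] /=.
    move=> h; split; first exact: (h ord0).
    by move=> i; have := h (lift ord0 i); rewrite /cons_pair tnthS.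
  move=> [h0 h] i; case: (unliftP ord0 i) => [j|] ->; last exact: h0.
  by rewrite /cons_pair tnthS; exact: h.
rewrite product_measure1E//.
rewrite [X in measurable X](_ : _ =
    \bigcap_(i in [set: 'I_n]) ((@tnth n T)^~ i @^-1` B (lift ord0 i))).
  apply: fin_bigcap_measurable => // i _; rewrite -[X in measurable X]setTI.
  exact: measurable_tnth.
by apply/seteqP; split => y /= h i; [move=> _; exact: h|exact: h].
Qed.

End iid_law.

(* The sequence (d_i)_{i >= 1} is a function on nat whose value at 0 is never
   used; the entry y_i of the 0-indexed tuple is paired with d_{i+1}. *)
Section mu_law.
Context (R : realType) (d : nat -> nat) (M : nat).

Definition standardized_sum (y : M.-tuple (measurableTypeR R)) :
    measurableTypeR R :=
  (\sum_(i < M) (d i.+1)%:R^-1 * ((tnth y i : R) - 1)) /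
  Num.sqrt (\sum_(i < M) (d i.+1)%:R ^- 2) : R.

Lemma measurable_standardized_sum :
  measurable_fun [set: M.-tuple (measurableTypeR R)] standardized_sum.
Proof.
apply: measurable_funM => //.
apply: measurable_sum => i; apply: measurable_funM => //.
by apply: measurable_funB => //; exact: measurable_tnth.
Qed.

HB.instance Definition _ :=
  isMeasurableFun.Build _ _ _ _ standardized_sum measurable_standardized_sum.

(* mu_{n,K}^{(d_i),M}: in the growth process, conditionally on (b_i) = (d_i) and
   N = M, the X_i are independent exponentials of mean 1/d_i, that is,
   X_i = Y_i / d_i with Y_1, ..., Y_M i.i.d. exponential of mean 1. This law is
   the definition also when that event has probability 0. *)
Definition mu_law : probability (measurableTypeR R) R :=
  distribution (iid_law (exponential1 R) M) standardized_sum.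

End mu_law.

Definition Upsilon (R : realType) (a : R) (n K : nat) :
    set ((nat -> nat) * nat) :=
  [set dM | let: (d, M) := dM in
    [/\ a * n%:R * K%:R / 2 <= M%:R /\ (M <= n * (K + 1))%N,
        forall i, (1 <= i)%N -> (K + 1 <= d i)%N
      & a * M%:R / 2 <=
          (count (fun i => (d i)%:R <= 4 * K%:R / a) (iota 1 M))%:R]].

Definition vertex : choiceType := (int * int)%type.

Definition origin : vertex := (0, 0).

Definition adjacent : rel vertex :=
  fun x y => `|x.1 - y.1| + `|x.2 - y.2| == 1.

(* An undirected edge is the set of its two endpoints. Families indexed by this
   type are only constrained on nn_edges. *)
Definition edge : choiceType := {fset vertex}.

Definition nn_edges : set edge :=
  [set e | exists x y : vertex, adjacent x y /\ e = [fset x; y]%fset].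

(* The path that starts at x and then visits the vertices of s in order. *)
Definition path_edges (x : vertex) (s : seq vertex) : seq edge :=
  pairmap (fun y z => [fset y; z]%fset) x s.

Definition self_avoiding_path (x : vertex) (s : seq vertex) : bool :=
  path adjacent x s && uniq (x :: s).

Section percolation.
Context d (T : measurableType d) (R : realType) (P : probability T R).

Definition iid_exponential_weights (t : edge -> {RV P >-> R}) : Prop :=
  mutually_independent nn_edges t /\
  forall e, nn_edges e -> has_law (t e) (exponential1 R).

Definition passage_time (t : edge -> {RV P >-> R}) (s : seq vertex) (w : T) : R :=
  \sum_(e <- path_edges origin s) t e w.

Definition kesten_constants (t : edge -> {RV P >-> R}) (a c' : R) : Prop :=
  [/\ 0 < a, 0 < c' & forall k, (1 <= k)%N ->
    (P [set w | exists s : seq vertex,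
          [/\ self_avoiding_path origin s, (k <= size (path_edges origin s))%N
            & (passage_time t s w <= a * k%:R)%R]]
     <= (expR (- c' * k%:R))%:E)%E].

End percolation.

(* Main.v *)
Require Import Defs.
From HB Require Import structures.
From mathcomp Require Import all_boot all_order all_algebra finmap.
From mathcomp Require Import all_classical all_reals all_analysis.
From mathcomp Require Import measurable_realfun.
From mathcomp Require Import ring lra.

Set Implicit Arguments.
Unset Strict Implicit.
Unset Printing Implicit Defensive.

Import Order.TTheory GRing.Theory Num.Theory.
Import numFieldNormedType.Exports.

Local Open Scope classical_set_scope.
Local Open Scope ring_scope.

(* Stein's method. Write W = sum_i w_i (Y_i - 1) for the standardized sum, so that
   sum_i w_i^2 = 1. Integration by parts against e^-y gives
   E[(Y - 1) F(Y)] = E[Y F'(Y)] for an exponential Y, hence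
   E[W f(W)] = sum_i w_i^2 E[Y_i f'(W)]. For continuous h with values in [0, 1],
   the Stein equation f'(x) - x f(x) = h(x) - E h(Z) has a C^1 solution with
   |f'| <= 2, and then
     E h(W) - E h(Z) = E[f'(W) - W f(W)] = - E[f'(W) V],
   where V = sum_i w_i^2 (Y_i - 1). As E V^2 = sum_i w_i^4, the difference is at
   most 2 sqrt(sum_i w_i^4). This passes to indicators of Borel sets by
   approximation, and the conditions defining Upsilon bound sum_i w_i^4. The
   coupling is the maximal one, built on a Hahn decomposition of the difference
   of the two laws. *)

(** The integrations by parts need a continuous [f'], whereas the Stein solution for an indicator
    has a derivative that jumps. Hence the Stein equation is solved for continuous [h] only. The
    bound 2 on [f'] comes from [|h - E h(Z)| <= 1] and [|x f(x)| <= 1]; it does not involve the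
    modulus of continuity of [h], which is why the estimate survives the passage to Borel sets. The
    constant of the theorem is reached by majorization. The squared estimate is [4 * sum_i w_i^4].
    Since [d_i >= K + 1], the sum is at most [1 / ((K + 1)^2 S)] with [S = sum_i d_i^-2], and the
    counting condition gives [S >= a^4 n / (64 K)]; together they yield [256 / (a^4 n (K + 1))]. The
    same counting condition forces [a <= 2], so [a^-4 <= 16 a^-8], and
    [256 * 16 / 2^15 = 1/8 <= log (2 pi) - 1]. *)

(** * Integration tools: measures with a density, and the half-line *)

Section density.
Context d (T : measurableType d) (R : realType).
Variables (nu : {finite_measure set T -> \bar R})
  (mu : {sigma_finite_measure set T -> \bar R}) (p : T -> R).
Hypotheses (p0 : forall x, 0 <= p x) (mp : measurable_fun setT p)
  (nuE : forall A, measurable A -> nu A = (\int[mu]_(x in A) (p x)%:E)%E).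

Let numu : nu `<< mu.
Proof.
apply/null_content_dominatesP => A mA A0; rewrite nuE//.
by apply: null_set_integral => //; exact/measurable_EFinP/measurable_funTS.
Qed.

Let ip : mu.-integrable setT (EFin \o p).
Proof.
apply/integrableP; split; first exact/measurable_EFinP.
under eq_integral do rewrite /= ger0_norm//.
by rewrite -nuE// ltey_eq fin_num_measure.
Qed.

(** The Radon-Nikodym derivative of [nu] and the given [p] have the same integral over every
    measurable set, so they agree almost everywhere, and the change of variables for the former
    transfers to [p]. *)
Lemma ge0_integral_density (f : T -> \bar R) :
  (forall x, 0 <= f x)%E -> measurable_fun setT f ->
  (\int[nu]_x f x = \int[mu]_x (f x * (p x)%:E))%E.
Proof.
move=> f0 mf; rewrite -(Radon_Nikodym_SigmaFinite.change_of_variables numu)//.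
have mg := measurable_int _ (Radon_Nikodym_SigmaFinite.f_integrable numu).
apply: ae_eq_integral => //.
- exact: emeasurable_funM.
- by apply: emeasurable_funM => //; exact/measurable_EFinP.
apply: ae_eqe_mul2l; apply: integral_ae_eq => //.
- exact: Radon_Nikodym_SigmaFinite.f_integrable.
- exact/measurable_EFinP.
- by move=> A _ mA; rewrite -Radon_Nikodym_SigmaFinite.f_integral// nuE.
Qed.

Lemma integrable_density (f : T -> R) : measurable_fun setT f ->
  mu.-integrable setT (fun x => (f x * p x)%:E) ->
  nu.-integrable setT (EFin \o f).
Proof.
move=> mf /integrableP[_]; under eq_integral do
  rewrite /= normrM (ger0_norm (p0 _)) EFinM.
move=> fp; apply/integrableP; split; first exact/measurable_EFinP.
by rewrite ge0_integral_density//; do 2 apply: measurableT_comp => //.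
Qed.

Lemma integral_density (f : T -> R) : measurable_fun setT f ->
  (\int[nu]_x (f x)%:E = \int[mu]_x (f x * p x)%:E)%E.
Proof.
move=> mf; have mf' : measurable_fun setT (EFin \o f) by exact/measurable_EFinP.
rewrite integralE [RHS]integralE.
rewrite !ge0_integral_density//; [|exact: measurable_funeneg|exact: measurable_funepos].
congr (_ - _)%E; apply: eq_integral => x _.
- by rewrite !funeposE EFinM maxe_pMl ?lee_fin// mul0e.
- by rewrite !funenegE EFinM maxe_pMl ?lee_fin// mul0e mulNe.
Qed.
End density.


(** The Stein integrand changes sign, so monotone convergence does not apply; the integrals over
    [[a, a + n + 1]] converge by domination by [|f|]. *)
Lemma integrable_continuous_FTC2y (R : realType) (f F : R -> R) (a l : R) :
  continuous f -> (forall x : R, is_derive x 1 F (f x)) ->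
  (@lebesgue_measure R).-integrable `[a, +oo[ (EFin \o f) ->
  F x @[x --> +oo] --> l ->
  (\int[lebesgue_measure]_(x in `[a, +oo[) (f x)%:E = (l - F a)%:E)%E.
Proof.
move=> cf dF intf Fl.
have dvF x : derivable F x 1 by have [] := dF x.
have cF : continuous F.
  by move=> x; apply/differentiable_continuous/derivable1_diffP.
pose b n : R := a + n.+1%:R.
have ab n : a < b n by rewrite /b ltrDl ltr0n.
pose f_ n x := ((f \_ `[a, b n]) x)%:E.
have f_E n : (\int[lebesgue_measure]_(x in `[a, +oo[) f_ n x =
    (F (b n) - F a)%:E)%E.
  rewrite EFinB -(@continuous_FTC2 _ f F a (b n))//.
  - rewrite [RHS]integral_mkcond [LHS]integral_mkcond.
    apply: eq_integral => x _; rewrite /f_ !patchE.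
    case: ifPn => [_|/negP xa]; case: ifPn => //.
    rewrite inE/= in_itv/= => /andP[ax _]; exfalso; apply: xa.
    by rewrite inE/= in_itv/= ax.
  - exact: continuous_subspaceT.
  - split; [by []|exact/cvg_at_right_filter/cF|exact/cvg_at_left_filter/cF].
  - by move=> x _; rewrite derive1E; have [_ ->] := dF x.
have [] := @dominated_convergence _ _ _ (@lebesgue_measure R) `[a, +oo[
  (measurable_itv _) f_ (EFin \o f) (fun x => `|f x|%:E).
- move=> n; apply/measurable_EFinP/measurable_funTS/measurable_restrict => //.
  by rewrite setTI; apply: measurable_funTS; exact: continuous_measurable_fun.
- by apply/measurable_EFinP/measurable_funTS; exact: continuous_measurable_fun.
- apply: aeW => x /=; rewrite in_itv/= andbT => ax.
  apply: cvg_near_cst; near=> n.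
  rewrite /f_ patchE ifT// inE/= in_itv/= ax/= -lerBlDl.
  by apply: (@le_trans _ _ n%:R); [near: n; exact: nbhs_infty_ger|rewrite ler_nat].
- exact: integrable_norm intf.
- apply: aeW => x n _; rewrite /f_ patchE /=.
  by case: ifPn => _; rewrite lee_fin// normr0.
move=> _ _; under eq_fun do rewrite f_E.
move/cvg_unique; apply => //; apply: cvg_EFin; first exact: nearW.
apply: cvgB; last exact: cvg_cst.
apply: (cvg_pinftyP F l).1 Fl _ _; apply/cvgryPge => r; near=> n.
rewrite -lerBlDl; apply: (@le_trans _ _ n%:R); last by rewrite ler_nat.
by near: n; exact: nbhs_infty_ger.
Unshelve. all: by end_near. Qed.

(** * Stein identity for exponential variables *)

Section exponential.
Context {R : realType}.
Implicit Types (f F : R -> R) (x C : R).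
Notation mu := (@lebesgue_measure R).

(** Half of the exponent absorbs the quadratic factor, because [expR (x / 2) >= 1 + x^2 / 8]. What
    remains is, up to a constant, the exponential density of rate 1/2, which is known to be
    integrable. *)
Lemma expRN_sqr_le x : 0 <= x -> (1 + x ^+ 2) * expR (- x) <= 8 * expR (- (x / 2)).
Proof.
move=> x0; have h0 : 0 <= x / 2 by rewrite divr_ge0.
have h := expR_ge1Dxn 1 h0.
have -> : expR (- x) = expR (- (x / 2)) / expR (x / 2).
  by rewrite -expRB; congr expR; lra.
rewrite mulrCA [leRHS]mulrC ler_wpM2l ?expR_ge0//.
rewrite ler_pdivrMr ?expR_gt0//.
move: h; rewrite [2`!%:R](_ : _ = 2)// => h.
by apply: (le_trans _ (ler_wpM2l _ h)) => //; nra.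
Qed.

Lemma integrable_expRN f C : measurable_fun setT f ->
  (forall x, 0 <= x -> `|f x| <= C * (1 + x ^+ 2)) ->
  mu.-integrable `[0, +oo[ (fun x => (f x * expR (- x))%:E).
Proof.
move=> mf fC.
have C0 : 0 <= C by have := fC 0 (lexx _); rewrite expr0n addr0 mulr1; exact: le_trans.
have me : measurable_fun [set: R] (fun x => expR (- x)) by exact: measurableT_comp.
(* The density of rate 1/2 carries a factor 1/2, so the 8 of [expRN_sqr_le] becomes 16. *)
apply: (@le_integrable _ (measurableTypeR R) R mu `[0, +oo[%classic _ _
    (fun x => (C * 16)%:E * (exponential_pdf 2^-1 x)%:E)%E) => //.
- by apply/measurable_EFinP/measurable_funTS; exact: measurable_funM.
- move=> x /=; rewrite in_itv/= andbT => x0.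
  rewrite lee_fin normrM (ger0_norm (expR_ge0 _)) exponential_pdfE//.
  rewrite [leRHS]ger0_norm ?mulr_ge0 ?expR_ge0//.
  apply: (le_trans (ler_wpM2r (expR_ge0 _) (fC _ x0))).
  rewrite -!mulrA ler_wpM2l//; apply: (le_trans (expRN_sqr_le x0)).
  by rewrite mulNr [2^-1 * x]mulrC mulrA ler_wpM2r ?expR_ge0//; lra.
- apply: integrableZl => //; apply: (integrableS measurableT) => //.
  by apply: integrable_exponential_pdf; rewrite invr_gt0.
Qed.

Lemma integral_exponential1 f : measurable_fun setT f ->
  (\int[exponential1 R]_x (f x)%:E =
   \int[mu]_(x in `[0%R, +oo[) (f x * expR (- x))%:E)%E.
Proof.
move=> mf; rewrite (@integral_density _ _ _ (exponential1 R) mu (exponential_pdf 1))//.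
- rewrite [RHS]integral_mkcond; apply: eq_integral => x _.
  rewrite /exponential_pdf !patchE; case: ifPn => _; last by rewrite mulr0.
  by rewrite mul1r mulN1r.
- by move=> x; apply: exponential_pdf_ge0.
- exact: measurable_exponential_pdf.
Qed.

Lemma integrable_exponential1 f C : measurable_fun setT f ->
  (forall x, 0 <= x -> `|f x| <= C * (1 + x ^+ 2)) ->
  (exponential1 R).-integrable setT (EFin \o f).
Proof.
move=> mf fC; apply: (@integrable_density _ _ _ _ mu (exponential_pdf 1)) => //.
- by move=> x; apply: exponential_pdf_ge0.
- exact: measurable_exponential_pdf.
have := integrable_expRN mf fC; rewrite integrable_mkcond//.
apply: eq_integrable => // x _.
rewrite /exponential_pdf !patchE; case: ifPn => _; last by rewrite mulr0.
by rewrite mul1r mulN1r.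
Qed.

(* That is, y is a Stein kernel of the centred law of Y - 1. *)
Lemma exponential1_stein F (F' : R -> R) C :
  continuous F' -> (forall x, is_derive x 1 F (F' x)) ->
  (forall x, `|F x| <= C * (1 + `|x|)) -> (forall x, `|F' x| <= C) ->
  (\int[exponential1 R]_x ((x - 1) * F x - x * F' x)%:E = 0)%E.
Proof.
move=> cF' dF FC F'C.
have C0 : 0 <= C by exact: le_trans (F'C 0).
have cF : continuous F.
  move=> x; apply/differentiable_continuous/derivable1_diffP.
  by have [] := dF x.
have cf : continuous (fun x => (x - 1) * F x - x * F' x).
  move=> x; apply: cvgB; apply: cvgM; [|exact: cF|exact: cvg_id|exact: cF'].
  by apply: cvgB; [exact: cvg_id|exact: cvg_cst].
have ce : continuous (fun x : R => expR (- x)).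
  move=> x; apply: continuous_comp; last exact: continuous_expR.
  by apply: cvgN; exact: cvg_id.
have mf := continuous_measurable_fun cf.
rewrite integral_exponential1//.
(* An explicit antiderivative of the integrand: the factor [y] kills it at 0, the exponential at
   infinity. *)
have dG (x : R) : is_derive x 1 (fun y => - (y * F y * expR (- y)))
    (((x - 1) * F x - x * F' x) * expR (- x)).
  have dFx := dF x.
  have de : is_derive x 1 (fun y : R => expR (- y)) (- expR (- x)).
    have -> : (fun y : R => expR (- y)) = expR \o (fun y => - y) by [].
    by apply: is_derive_eq; rewrite /GRing.scale/= mulrN1.
  by apply: is_derive_eq; rewrite /GRing.scale/=; ring.
rewrite (@integrable_continuous_FTC2y _ _ _ _ 0 _ dG)//.
- by rewrite !mul0r !oppr0 ?subr0 ?subrr ?addr0.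
- by move=> x; apply: cvgM; [exact: cf|exact: ce].
- apply: (@integrable_expRN _ (3 * C)) => // x x0.
  apply: (le_trans (ler_normB _ _)); rewrite !normrM (ger0_norm x0).
  have h1 : `|x - 1| <= 1 + x.
    by apply: (le_trans (ler_normB _ _)); rewrite normr1 (ger0_norm x0) addrC.
  have := FC x; rewrite (ger0_norm x0) => h2.
  have h3 := F'C x.
  have := ler_pM (normr_ge0 _) (normr_ge0 _) h1 h2.
  have := ler_wpM2l x0 h3.
  have : 0 <= C * (2 - 3 * x + 2 * x ^+ 2) by rewrite mulr_ge0//; have := sqr_ge0 (x - 3 / 4); lra.
  by move: (`|x - 1| * _) (x * `|_|) => u v; lra.
rewrite -oppr0; apply: cvgN; apply/cvgrPdist_le => e e0.
(* For [x >= 0], [x * |F x| <= 2 * C * (1 + x^2)], and [expRN_sqr_le] contributes the other factor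
   8. *)
have : (16 * C) * expR (- (2^-1 * x)) @[x --> +oo] --> (16 * C) * 0.
  apply: cvgMr; apply: (@cvg_comp _ _ _ _ (fun x => expR (- x)) _ (pinfty_nbhs R)); last exact: cvgr_expR.
  by apply: gt0_cvgMry => //; exact: cvg_id.
rewrite mulr0 => /cvgrPdist_le/(_ _ e0); apply: filter_app; near=> x.
rewrite !sub0r !normrN; apply: le_trans.
have x0 : 0 <= x by near: x; exact: nbhs_pinfty_ge.
rewrite !normrM (ger0_norm x0) (ger0_norm C0) (ger0_norm (ler0n _ 16)) !(ger0_norm (expR_ge0 _)).
have := expRN_sqr_le x0; rewrite [_ / 2]mulrC.
have := FC x; rewrite (ger0_norm x0).
have := expR_ge0 (- x).
move: (expR (- x)) (`|F x|) => u w u0 h1 h2.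
have : x * w <= 2 * C * (1 + x ^+ 2).
  move: h1 => /(ler_wpM2l x0) /le_trans; apply.
  have : 0 <= C * (2 - x + x ^+ 2).
    by rewrite mulr_ge0//; have := sqr_ge0 (x - 1 / 2); lra.
  lra.
move=> /(ler_wpM2r u0) /le_trans; apply.
have := ler_wpM2l C0 h2; lra.
Unshelve. all: by end_near. Qed.

End exponential.

(** * Integration of one coordinate under the product law *)

Section iid.
Context d (T : measurableType d) (R : realType).
Implicit Types (mu : probability T R) (n : nat).

Definition set_coord n (i : 'I_n) (y : n.-tuple T) (x : T) : n.-tuple T :=
  [tuple if j == i then x else tnth y j | j < n].

Lemma tnth_set_coord n (i j : 'I_n) y x :
  tnth (set_coord i y x) j = if j == i then x else tnth y j.
Proof. by rewrite tnth_mktuple. Qed.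

Lemma set_coord0 n (x0 x : T) (y : n.-tuple T) :
  set_coord ord0 (cons_pair (x0, y)) x = cons_pair (x, y).
Proof.
apply: eq_from_tnth => k; rewrite tnth_set_coord.
by case: (unliftP ord0 k) => [l|] ->; rewrite ?eqxx// /cons_pair !tnthS.
Qed.

Lemma set_coord_lift n (j : 'I_n) (x x' : T) (y : n.-tuple T) :
  set_coord (lift ord0 j) (cons_pair (x, y)) x' = cons_pair (x, set_coord j y x').
Proof.
apply: eq_from_tnth => k; rewrite tnth_set_coord.
case: (unliftP ord0 k) => [l|] -> //.
by rewrite (inj_eq lift_inj) /cons_pair !tnthS tnth_set_coord.
Qed.

(** Fubini along the recursion that defines [iid_law]. For a lifted index the tail is integrated
    first, and the induction hypothesis applies for almost every head; for the index 0 the head is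
    integrated first. This carries a one-variable identity, written as a vanishing integral, over to
    the product. *)
Lemma integral_iid0 mu n (i : 'I_n) (D : n.-tuple T -> R) :
  (iid_law mu n).-integrable setT (EFin \o D) ->
  (forall y, \int[mu]_x (D (set_coord i y x))%:E = 0)%E ->
  (\int[iid_law mu n]_y (D y)%:E = 0)%E.
Proof.
elim: n i D => [[]//|n IHn] i D iD D0.
have mD := measurable_int _ iD.
have iDc : (mu \x iid_law mu n)%E.-integrable setT
    (fun z => (D (cons_pair z))%:E).
  apply/integrableP; split; first exact: (measurableT_comp mD).
  have /integrableP[_] := iD; rewrite /= /distribution.
  rewrite ge0_integral_pushforward//.
  by apply/measurable_EFinP/measurableT_comp => //; exact/measurable_EFinP.
rewrite /= integral_pushforward// preimage_setT/=.
case: (unliftP ord0 i) => [j|] ij.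
  rewrite -(integral12_prod_meas1 iDc) -[RHS](@integral0 _ _ _ mu setT).
  apply: ae_eq_integral => //.
    exact: (measurable_fubini_F iDc).
  apply: filterS (ae_integrable1 iDc) => x ix _.
  apply: (IHn j (fun y => D (cons_pair (x, y)))) => // y.
  by rewrite -[RHS](D0 (cons_pair (x, y))) ij; under [RHS]eq_integral do rewrite set_coord_lift.
rewrite -(integral21_prod_meas1 iDc).
apply: integral0_eq => y _.
(* The head [point] is arbitrary: [set_coord] overwrites it. *)
rewrite -(D0 (cons_pair (point, y))) ij.
by under [RHS]eq_integral do rewrite set_coord0.
Qed.

(** The marginal law of a coordinate is [mu], by [iid_law_box] for a box whose other sides are the
    whole space. *)
Lemma ge0_integral_iid_coord mu n (i : 'I_n) (f : T -> \bar R) :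
  measurable_fun setT f -> (forall x, 0 <= f x)%E ->
  (\int[iid_law mu n]_y f (tnth y i) = \int[mu]_x f x)%E.
Proof.
move=> mf f0.
have -> : (\int[iid_law mu n]_y f (tnth y i) =
    \int[pushforward (iid_law mu n) (fun y => tnth y i)]_x f x)%E.
  by rewrite ge0_integral_pushforward//; exact: measurable_tnth.
apply: eq_measure_integral => [|mt A mA _]; first exact: measurable_tnth.
rewrite -[LHS]/(iid_law mu n ((fun y => tnth y i) @^-1` A)).
rewrite (_ : _ @^-1` A = [set y | forall j, (if j == i then A else setT) (tnth y j)]).
  rewrite (@iid_law_box _ _ _ mu n (fun j => if j == i then A else setT)) => [|j]; last by case: ifP.
  rewrite (bigD1 i)//= eqxx big1 ?mule1// => j /negPf ->.
  exact: probability_setT.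
apply/seteqP; split => y /= h; last by have := h i; rewrite eqxx.
by move=> j; case: eqP => [->|].
Qed.

Lemma integrable_iid_coord mu n (i : 'I_n) (f : T -> R) :
  mu.-integrable setT (EFin \o f) ->
  (iid_law mu n).-integrable setT (fun y => (f (tnth y i))%:E).
Proof.
move=> /integrableP[mf fi]; apply/integrableP; split.
  by apply: (measurableT_comp mf); exact: measurable_tnth.
rewrite (@ge0_integral_iid_coord _ _ i (fun x => `|(f x)%:E|)%E)//.
exact: measurableT_comp.
Qed.

End iid.

(** * Stein identity for weighted sums of centred exponentials *)

Section centred_sum.
Context (R : realType) (M : nat).
Implicit Types (w : 'I_M -> R) (i j : 'I_M) (y : M.-tuple (measurableTypeR R)).
Notation P := (iid_law (exponential1 R) M).

(** The weights are left free because the sum is used twice: with [w] it is the standardized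
    variable, with the squares of [w] it is the error term [V]. *)
Definition centred_sum w y : R := \sum_(i < M) w i * ((tnth y i : R) - 1).

Lemma measurable_coord i : measurable_fun setT (fun y => tnth y i : R).
Proof. exact: measurable_tnth. Qed.

Lemma measurable_centred_sum w : measurable_fun setT (centred_sum w).
Proof.
apply: measurable_sum => i; apply: measurable_funM => //.
by apply: measurable_funB => //; exact: measurable_coord.
Qed.

Lemma centred_sum_set_coord w i y (x : R) :
  centred_sum w (set_coord i y x) =
  (\sum_(j < M | j != i) w j * ((tnth y j : R) - 1)) + w i * (x - 1).
Proof.
rewrite /centred_sum (bigD1 i)//= tnth_set_coord eqxx addrC; congr (_ + _).
by apply: eq_bigr => j /negPf ji; rewrite tnth_set_coord ji.
Qed.

Lemma integrable_coord i (f : R -> R) C : measurable_fun setT f ->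
  (forall x, 0 <= x -> `|f x| <= C * (1 + x ^+ 2)) ->
  P.-integrable setT (fun y => (f (tnth y i))%:E).
Proof.
move=> mf fC.
apply: (@integrable_iid_coord _ (measurableTypeR R) R (exponential1 R) M i f).
exact: (integrable_exponential1 mf fC).
Qed.

Let mX1 : measurable_fun [set: R] (fun x : R => x - 1).
Proof. exact: measurable_funB. Qed.

Lemma integrable_coordB1 i : P.-integrable setT (fun y => ((tnth y i : R) - 1)%:E).
Proof.
apply: (@integrable_coord i (fun x => x - 1) 2) => // x x0.
by rewrite ler_norml; apply/andP; split; nra.
Qed.

Lemma integrable_coord_id i : P.-integrable setT (fun y => (tnth y i : R)%:E).
Proof.
by apply: (@integrable_coord i id 2) => // x x0; rewrite ger0_norm//=; nra.
Qed.

Lemma integrable_coordB1M i j :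
  P.-integrable setT (fun y => (((tnth y i : R) - 1) * ((tnth y j : R) - 1))%:E).
Proof.
have sq k : P.-integrable setT (fun y => (((tnth y k : R) - 1) ^+ 2)%:E).
  apply: (@integrable_coord k (fun x => (x - 1) ^+ 2) 2) => [|x x0].
    exact: measurable_funX.
  by rewrite ger0_norm ?sqr_ge0//; nra.
apply: le_integrable (integrableD measurableT (sq i) (sq j)) => //.
  apply/measurable_EFinP/measurable_funM.
  - by apply: measurable_funB => //; exact: measurable_coord.
  - by apply: measurable_funB => //; exact: measurable_coord.
move=> y _; rewrite /= lee_fin normrM [leRHS]ger0_norm ?addr_ge0 ?sqr_ge0//.
rewrite -(real_normK (num_real ((tnth y i : R) - 1))).
rewrite -(real_normK (num_real ((tnth y j : R) - 1))).
by move: `|_| `|_| (normr_ge0 ((tnth y i : R) - 1)) (normr_ge0 ((tnth y j : R) - 1)) => u v; nra.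
Qed.

Lemma integrable_coordB1_sum i w :
  P.-integrable setT (fun y => (((tnth y i : R) - 1) * centred_sum w y)%:E).
Proof.
have -> : (fun y => (((tnth y i : R) - 1) * centred_sum w y)%:E) =
    (fun y => \sum_(j < M) (w j)%:E * (((tnth y i : R) - 1) * ((tnth y j : R) - 1))%:E)%E.
  apply/funext => y; rewrite /centred_sum mulr_sumr -sumEFin.
  by apply: eq_bigr => j _; rewrite -EFinM; congr EFin; ring.
apply: integrable_sum => // j _; apply: integrableZl => //.
exact: integrable_coordB1M.
Qed.

Section stein.
Variables (w : 'I_M -> R) (f f' : R -> R) (C : R).
Hypotheses (cf' : continuous f') (df : forall x : R, is_derive x 1 f (f' x))
  (fC : forall x, `|f x| <= C * (1 + `|x|)) (f'C : forall x, `|f' x| <= C).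

Let C0 : 0 <= C. Proof. exact: le_trans (f'C 0). Qed.

Let cf : continuous f.
Proof.
by move=> x; apply/differentiable_continuous/derivable1_diffP; have [] := df x.
Qed.

Let mfW : measurable_fun setT (fun y => f (centred_sum w y)).
Proof.
by apply: measurableT_comp; [exact: continuous_measurable_fun|exact: measurable_centred_sum].
Qed.

Let mf'W : measurable_fun setT (fun y => f' (centred_sum w y)).
Proof.
by apply: measurableT_comp; [exact: continuous_measurable_fun|exact: measurable_centred_sum].
Qed.

(** The linear growth of [f] gives the dominating function [C * (|Y_i - 1| + |(Y_i - 1) W|)]. *)
Lemma integrable_coordB1_comp i :
  P.-integrable setT (fun y => (((tnth y i : R) - 1) * f (centred_sum w y))%:E).
Proof.
have := integrableD measurableT (integrable_norm (integrable_coordB1 i))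
  (integrable_norm (integrable_coordB1_sum i w)).
move=> /(integrableZl measurableT C); apply: le_integrable => //.
  apply/measurable_EFinP/measurable_funM => //.
  by apply: measurable_funB => //; exact: measurable_coord.
move=> y _ /=; rewrite lee_fin !normrM (ger0_norm C0).
rewrite [X in _ <= _ * X]ger0_norm ?addr_ge0 ?mulr_ge0//.
have := ler_wpM2l (normr_ge0 ((tnth y i : R) - 1)) (fC (centred_sum w y)).
by move=> /le_trans; apply; lra.
Qed.

Lemma integrable_coord_comp i :
  P.-integrable setT (fun y => ((tnth y i : R) * f' (centred_sum w y))%:E).
Proof.
have := integrableZl measurableT C (integrable_norm (integrable_coord_id i)).
apply: le_integrable => //.
  by apply/measurable_EFinP/measurable_funM => //; exact: measurable_coord.
move=> y _ /=; rewrite lee_fin !normrM (ger0_norm C0) normr_id mulrC.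
by rewrite ler_wpM2r.
Qed.

(** With the other coordinates frozen, the sum is [c + w i * (x - 1)], and [exponential1_stein]
    applies to [F x = f (c + w i * (x - 1))]; the chain rule produces the factor [w i]. *)
Lemma stein_centred_sum i :
  (\int[P]_y (((tnth y i : R) - 1) * f (centred_sum w y))%:E =
   (w i)%:E * \int[P]_y ((tnth y i : R) * f' (centred_sum w y))%:E)%E.
Proof.
have i1 := integrable_coordB1_comp i; have i2 := integrable_coord_comp i.
have i2' := integrableZl measurableT (w i) i2.
rewrite -integralZl//; apply/eqP; rewrite -[eqbRHS]add0e -sube_eq; last 2 first.
- exact: (integrable_fin_num measurableT i1).
- exact/fin_num_adde_defl/(integrable_fin_num measurableT i2').
rewrite -integralB//; apply/eqP.
apply: (@integral_iid0 _ _ _ _ _ i (fun y => ((tnth y i : R) - 1) * f (centred_sum w y)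
  - w i * ((tnth y i : R) * f' (centred_sum w y)))).
  by have := integrableB measurableT i1 i2'; apply: eq_integrable.
move=> y; set c := \sum_(j < M | j != i) w j * ((tnth y j : R) - 1).
(* The constant [C * (1 + |c| + |w i|)] serves both the growth of [F] and the bound on its
   derivative. It may depend on [c], as the identity is exact for each fixed [y]. *)
rewrite -[RHS](@exponential1_stein _ (fun x => f (c + w i * (x - 1)))
  (fun x => w i * f' (c + w i * (x - 1))) (C * (1 + `|c| + `|w i|))).
- apply: eq_integral => x _; rewrite centred_sum_set_coord tnth_set_coord eqxx.
  by congr EFin; rewrite -/c; ring.
- move=> x; apply: cvgM; first exact: cvg_cst.
  apply: continuous_comp; last exact: cf'.
  apply: cvgD; first exact: cvg_cst.
  by apply: cvgM; [exact: cvg_cst|apply: cvgB; [exact: cvg_id|exact: cvg_cst]].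
- move=> x; have dfx := df (c + w i * (x - 1)).
  have dg : is_derive x 1 (fun x : R => c + w i * (x - 1)) (w i).
    by apply: is_derive_eq; rewrite /GRing.scale/=; ring.
  have -> : (fun x => f (c + w i * (x - 1))) = f \o (fun x => c + w i * (x - 1)) by [].
  by apply: is_derive_eq; rewrite /GRing.scale/=; ring.
- move=> x; apply: (le_trans (fC _)); rewrite -mulrA ler_wpM2l//.
  have : `|c + w i * (x - 1)| <= `|c| + `|w i| * (`|x| + 1).
    apply: (le_trans (ler_normD _ _)); rewrite lerD2l normrM ler_wpM2l//.
    by apply: (le_trans (ler_normB _ _)); rewrite normr1.
  have := normr_ge0 x; have := normr_ge0 c.
  by move: `|x| `|c| `|w i| `|_| => x' c' w' v; nra.
- move=> x; rewrite normrM mulrC; apply: ler_pM => //.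
  by rewrite lerDr addr_ge0.
Qed.
End stein.
End centred_sum.

(** * Moments and the Stein bound *)

Section bound.
Context (R : realType) (M : nat).
Implicit Types (w : 'I_M -> R) (i j : 'I_M).
Notation P := (iid_law (exponential1 R) M).

(** The Stein identity with [f = 1] and [f' = 0] says that [Y_i - 1] has mean 0. *)
Lemma integral_coord i : (\int[P]_y ((tnth y i : R))%:E = 1)%E.
Proof.
have := @stein_centred_sum R M (fun=> 0) (cst 1) (cst 0) 1.
move=> /(_ _ _ _ _ i); rewrite mul0e => h.
have {}h : (\int[P]_y ((tnth y i : R) - 1)%:E = 0)%E.
  rewrite -[RHS]h.
  - by apply: eq_integral => y _; rewrite mulr1.
  - exact: cst_continuous.
  - by move=> x; rewrite normr1 mul1r lerDl.
  - by move=> x; rewrite normr0.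
have -> : (fun y : M.-tuple (measurableTypeR R) => (tnth y i : R)%:E) =
    (fun y : M.-tuple (measurableTypeR R) => ((tnth y i : R) - 1)%:E + 1)%E.
  by apply/funext => y; rewrite -EFinD subrK.
rewrite integralD//; last 2 first.
- exact: integrable_coordB1.
- exact: finite_measure_integrable_cst.
by rewrite h add0e integral_cst// mul1e; exact: probability_setT.
Qed.

(** The Stein identity with [f = id] gives [E[(Y_i - 1) W] = w i * E[Y_i] = w i], so no product of
    two coordinates has to be evaluated. *)
Lemma integral_centred_sum_sqr w :
  (\int[P]_y (centred_sum w y ^+ 2)%:E = (\sum_(i < M) w i ^+ 2)%:E)%E.
Proof.
have h i : (\int[P]_y (((tnth y i : R) - 1) * centred_sum w y)%:E = (w i)%:E)%E.
  rewrite (@stein_centred_sum R M w id (cst 1) 1).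
  - under eq_integral do rewrite mulr1.
    by rewrite integral_coord mule1.
  - exact: cst_continuous.
  - by move=> x; rewrite mul1r lerDr.
  - by move=> x; rewrite normr1.
under eq_integral do rewrite expr2 {1}/centred_sum mulr_suml -sumEFin.
rewrite integral_sum//.
  rewrite -sumEFin; apply: eq_bigr => i _.
  under eq_integral do rewrite -mulrA EFinM.
  rewrite integralZl//; last exact: integrable_coordB1_sum.
  by rewrite h -EFinM expr2.
move=> i; have := integrableZl measurableT (w i) (integrable_coordB1_sum i w).
by apply: eq_integrable => // y _; rewrite /= -EFinM mulrA.
Qed.

Lemma integrable_centred_sum_sqr w :
  P.-integrable setT (fun y => (centred_sum w y ^+ 2)%:E).
Proof.
apply/integrableP; split.
  by apply/measurable_EFinP/measurable_funX; exact: measurable_centred_sum.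
under eq_integral do rewrite gee0_abs ?lee_fin ?sqr_ge0//.
by rewrite integral_centred_sum_sqr ltry.
Qed.

Variables (w : 'I_M -> R) (f f' : R -> R) (B C : R).
Hypotheses (cf' : continuous f') (df : forall x : R, is_derive x 1 f (f' x))
  (fC : forall x, `|f x| <= C * (1 + `|x|)) (f'B : forall x, `|f' x| <= B)
  (w1 : \sum_(i < M) w i ^+ 2 = 1).

(** The Stein identity takes one constant for [f] and [f']; [B] is kept apart because it alone
    enters the final bound. *)
Let D := Num.max B C.
Let fD x : `|f x| <= D * (1 + `|x|).
Proof. by apply: (le_trans (fC x)); rewrite ler_wpM2r ?addr_ge0// /D le_max lexx orbT. Qed.
Let f'D x : `|f' x| <= D. Proof. by apply: (le_trans (f'B x)); rewrite /D le_max lexx. Qed.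

Let B0 : 0 <= B. Proof. exact: le_trans (f'B 0). Qed.

Let mf'W : measurable_fun setT (fun y : M.-tuple (measurableTypeR R) => f' (centred_sum w y)).
Proof.
by apply: measurableT_comp; [exact: continuous_measurable_fun|exact: measurable_centred_sum].
Qed.

Let w2 i := w i ^+ 2.
Let V := centred_sum w2.

(** Summing the Stein identities with weights [w i] leaves [sum_i w_i^2 Y_i], which is [1 + V]
    because the squared weights add up to 1. *)
Let integral_centred_sumM :
  P.-integrable setT (fun y => (centred_sum w y * f (centred_sum w y))%:E) /\
  (\int[P]_y (centred_sum w y * f (centred_sum w y))%:E =
   \int[P]_y ((1 + V y) * f' (centred_sum w y))%:E)%E.
Proof.
have iw i := integrableZl measurableT (w i) (integrable_coordB1_comp w df fD f'D i).
have iw' i := integrableZl measurableT (w2 i) (integrable_coord_comp w cf' f'D i).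
have e y : (centred_sum w y * f (centred_sum w y))%:E =
   (\sum_(i < M) (w i)%:E * (((tnth y i : R) - 1) * f (centred_sum w y))%:E)%E.
  rewrite {1}/centred_sum mulr_suml -sumEFin; apply: eq_bigr => i _.
  by rewrite -mulrA EFinM.
have e' y : ((1 + V y) * f' (centred_sum w y))%:E =
   (\sum_(i < M) (w2 i)%:E * ((tnth y i : R) * f' (centred_sum w y))%:E)%E.
  rewrite -w1 /V {1}/centred_sum -big_split/= mulr_suml -sumEFin; apply: eq_bigr => i _.
  by rewrite -EFinM /w2; congr EFin; ring.
split.
  by under eq_fun do rewrite e; exact: integrable_sum.
under eq_integral do rewrite e.
under [RHS]eq_integral do rewrite e'.
rewrite integral_sum// integral_sum//; apply: eq_bigr => i _.
rewrite !integralZl//; last 2 first.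
- exact: (integrable_coord_comp w cf' f'D).
- exact: (integrable_coordB1_comp w df fD f'D).
by rewrite (stein_centred_sum w cf' df fD f'D) muleA -EFinM -expr2.
Qed.

Lemma stein_bound :
  (`|\int[P]_y (f' (centred_sum w y) - centred_sum w y * f (centred_sum w y))%:E|
   <= (B * Num.sqrt (\sum_(i < M) w i ^+ 4))%:E)%E.
Proof.
have [i1 i2] := integral_centred_sumM.
have if' : P.-integrable setT (fun y => (f' (centred_sum w y))%:E).
  have /le_integrable : P.-integrable setT (EFin \o cst B).
    exact: finite_measure_integrable_cst.
  apply => //; first exact/measurable_EFinP.
  by move=> y _; rewrite /= lee_fin (ger0_norm B0).
pose s := Num.sqrt (\sum_(i < M) w i ^+ 4).
have sE : s ^+ 2 = \sum_(i < M) w i ^+ 4.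
  by rewrite sqr_sqrtr// sumr_ge0// => i _; rewrite exprn_even_ge0.
(* The estimate of [V] below divides by [s]. If [s] were 0, all weights would vanish, against
   [w1]. *)
have s0 : 0 < s.
  have w4 i : 0 <= w i ^+ 4 by rewrite exprn_even_ge0.
  rewrite sqrtr_gt0 lt_neqAle sumr_ge0// andbT.
  apply/eqP => /esym/psumr_eq0P h.
  have : \sum_(i < M) w i ^+ 2 = 0.
    apply: big1 => i _; have /eqP := h (fun k _ => w4 k) i isT.
    by rewrite expf_eq0/= => /eqP ->; rewrite expr0n.
  by rewrite w1 => /eqP; rewrite oner_eq0.
have iV : P.-integrable setT (fun y => (2^-1 * (V y ^+ 2 / s + s))%:E).
  have : P.-integrable setT (EFin \o cst s) by exact: finite_measure_integrable_cst.
  move=> /(integrableD measurableT (integrableZl measurableT s^-1 (integrable_centred_sum_sqr w2))).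
  move=> /(integrableZl measurableT 2^-1); apply: eq_integrable => // y _.
  rewrite /= -[(s^-1%:E * _)%E]EFinM -EFinD -[LHS]EFinM; congr EFin.
  by rewrite [s^-1 * _]mulrC.
have mV : measurable_fun setT V by exact: measurable_centred_sum.
(* AM-GM: |V| <= (V^2 / s + s) / 2, which replaces Cauchy-Schwarz. *)
have le y : `|V y * f' (centred_sum w y)| <= B * (2^-1 * (V y ^+ 2 / s + s)).
  rewrite normrM mulrC; apply: ler_pM => //.
  rewrite -(real_normK (num_real (V y))); move: `|V y| => v.
  have -> : 2^-1 * (v ^+ 2 / s + s) = v + (v - s) ^+ 2 / (2 * s).
    by field; rewrite gt_eqF.
  by rewrite lerDl divr_ge0 ?sqr_ge0// mulr_ge0// ltW.
have iVf : P.-integrable setT (fun y => (V y * f' (centred_sum w y))%:E).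
  apply: le_integrable (integrableZl measurableT B iV) => //.
    by apply/measurable_EFinP/measurable_funM.
  move=> y _; rewrite /= lee_fin; apply: (le_trans (le y)).
  exact: ler_norm.
have -> : (\int[P]_y (f' (centred_sum w y) - centred_sum w y * f (centred_sum w y))%:E =
    - \int[P]_y (V y * f' (centred_sum w y))%:E)%E.
  under eq_integral do rewrite EFinB.
  rewrite integralB// i2.
  under [X in (_ - X)%E]eq_integral do rewrite mulrDl mul1r EFinD.
  rewrite integralD// fin_num_oppeD; last exact: (integrable_fin_num measurableT iVf).
  by rewrite addeA subee ?add0e//; exact: (integrable_fin_num measurableT if').
rewrite abseN; apply: (le_trans (le_abse_integral _ _ _)) => //.
  by apply/measurable_EFinP/measurable_funM.
apply: (@le_trans _ _ (\int[P]_y (B%:E * (2^-1 * (V y ^+ 2 / s + s))%:E)))%E.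
  apply: ge0_le_integral => //.
  - by apply/measurable_EFinP; apply: measurableT_comp => //; exact: measurable_funM.
  - by apply: emeasurable_funM => //; exact: (measurable_int _ iV).
  - by move=> y _; rewrite -EFinM lee_fin.
rewrite integralZl// EFinM lee_wpmul2l ?lee_fin//.
under eq_integral do rewrite EFinM.
rewrite integralZl//; last first.
  have := integrableZl measurableT 2 iV; apply: eq_integrable => // y _.
  by rewrite -EFinM mulrA divff ?mul1r.
under eq_integral do rewrite EFinD [_ / s]mulrC EFinM.
rewrite integralD//; last 2 first.
- exact: (integrableZl measurableT _ (integrable_centred_sum_sqr w2)).
- exact: finite_measure_integrable_cst.
rewrite integralZl//; last exact: integrable_centred_sum_sqr.
rewrite integral_centred_sum_sqr integral_cst//.
rewrite [X in (_ + _ * X)%E](_ : _ = 1%E); last exact: probability_setT.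
under eq_bigr do rewrite /w2 -exprM.
rewrite -/s mule1 -sE -[(s^-1%:E * _)%E]EFinM -EFinD -[leLHS]EFinM lee_fin.
suff -> : 2^-1 * (s^-1 * s ^+ 2 + s) = s by [].
by field; rewrite gt_eqF.
Qed.
End bound.

(** * Stein equation for the normal law *)

Section gaussian.
Context {R : realType}.
Implicit Types (x y t : R).
Notation mu := (@lebesgue_measure R).
Local Notation phi := (@normal_pdf R 0 1).

Lemma std_normal_pdfE x : phi x = normal_peak 1 * expR (- (x ^+ 2 / 2)).
Proof.
rewrite normal_pdfE ?oner_neq0// /normal_fun subr0 expr1n mulNr.
by rewrite mulr2n.
Qed.

Lemma std_normal_peak_gt0 : 0 < @normal_peak R 1.
Proof. by rewrite normal_peak_gt0// oner_neq0. Qed.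

Lemma std_normal_pdf_gt0 x : 0 < phi x.
Proof. by rewrite std_normal_pdfE mulr_gt0 ?expR_gt0 ?std_normal_peak_gt0. Qed.

Lemma std_normal_pdfN x : phi (- x) = phi x.
Proof. by rewrite !std_normal_pdfE sqrrN. Qed.

Lemma continuous_std_normal_pdf : continuous phi.
Proof. by apply: continuous_normal_pdf; rewrite oner_neq0. Qed.

Lemma is_derive_std_normal_pdf x : is_derive x 1 phi (- x * phi x).
Proof.
have -> : phi = (fun t => normal_peak 1 * expR (- (t ^+ 2 / 2))).
  by apply/funext => t; rewrite std_normal_pdfE.
have dg : is_derive x 1 (fun t : R => - (t ^+ 2 / 2)) (- x).
  by apply: is_derive_eq; rewrite /GRing.scale/=; field.
have de : is_derive x 1 (fun t : R => expR (- (t ^+ 2 / 2))) (- x * expR (- (x ^+ 2 / 2))).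
  have -> : (fun t : R => expR (- (t ^+ 2 / 2))) = expR \o (fun t => - (t ^+ 2 / 2)) by [].
  by apply: is_derive_eq; rewrite /GRing.scale/=; ring.
by apply: is_derive_eq; rewrite /GRing.scale/=; ring.
Qed.

Lemma cvg_std_normal_pdf : phi x @[x --> +oo] --> 0.
Proof.
have : normal_peak 1 * expR (- x) @[x --> +oo] --> normal_peak 1 * (0 : R).
  by apply: cvgMr; exact: cvgr_expR.
rewrite mulr0 => h; apply: (squeeze_cvgr _ (cvg_cst 0) h); near=> x.
rewrite ltW ?std_normal_pdf_gt0//= std_normal_pdfE ler_wpM2l ?normal_peak_ge0//.
have x2 : 2 <= x by near: x; exact: nbhs_pinfty_ge.
by rewrite ler_expR; nra.
Unshelve. all: by end_near. Qed.

Lemma integrable_std_normal_pdf (D : set R) : measurable D ->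
  mu.-integrable D (EFin \o phi).
Proof. by move=> mD; apply: integrableS (integrable_normal_pdf 0 1). Qed.

(** On the tail [x <= t], and [t * phi t] is the derivative of [- phi]. *)
Lemma std_normal_tail_le x : 0 <= x ->
  x * \int[mu]_(t in `[x, +oo[) phi t <= phi x.
Proof.
move=> x0; rewrite -lee_fin EFinM /Rintegral fineK; last first.
  by apply: integrable_fin_num => //; exact: integrable_std_normal_pdf.
have cid_phi : continuous (fun t => t * phi t).
  by move=> t; apply: cvgM; [exact: cvg_id|exact: continuous_std_normal_pdf].
have -> : ((phi x)%:E = \int[mu]_(t in `[x, +oo[) (t * phi t)%:E)%E.
  rewrite (@ge0_continuous_FTC2y _ _ (fun t => - phi t) _ 0)//.
  - by rewrite -EFinB sub0r opprK.
  - by move=> t xt; rewrite mulr_ge0 ?normal_pdf_ge0// (le_trans x0).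
  - exact: continuous_subspaceT.
  - rewrite -[X in _ --> X]oppr0; apply: cvgN; exact: cvg_std_normal_pdf.
  - by move=> t _; have := is_derive_std_normal_pdf t => ?; exact: ex_derive.
  - by apply: cvgN; apply/cvg_at_right_filter; exact: continuous_std_normal_pdf.
  - move=> t _; have := is_derive_std_normal_pdf t => ?.
    by rewrite derive1E derive_val mulNr opprK.
rewrite -ge0_integralZl//; first last.
- by move=> t _; rewrite lee_fin normal_pdf_ge0.
- by apply/measurable_EFinP/measurable_funTS; exact: measurable_normal_pdf.
apply: ge0_le_integral => //.
- by move=> t _; rewrite -EFinM lee_fin mulr_ge0 ?normal_pdf_ge0.
- by apply/measurable_EFinP/measurable_funM => //; apply/measurable_funTS; exact: measurable_normal_pdf.
- by apply/measurable_EFinP/measurable_funTS; exact: continuous_measurable_fun.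
move=> t /=; rewrite in_itv/= andbT => xt.
by rewrite -EFinM lee_fin ler_wpM2r ?normal_pdf_ge0.
Qed.

Lemma std_normal_left_tailE x :
  \int[mu]_(t in `]-oo, x]) phi t = \int[mu]_(t in `[- x, +oo[) phi t.
Proof.
rewrite /Rintegral -{1}(opprK x) ge0_integration_by_substitutionNy.
- by congr fine; apply: eq_integral => t _; rewrite /= std_normal_pdfN.
- by apply: continuous_subspaceT; exact: continuous_std_normal_pdf.
- by move=> t _; exact: normal_pdf_ge0.
Qed.

Lemma integral_gaussian (h : R -> R) : measurable_fun setT h ->
  (\int[gaussian R]_x (h x)%:E = \int[mu]_x (h x * phi x)%:E)%E.
Proof.
move=> mh; apply: (@integral_density _ _ _ (gaussian R) mu phi) => //.
- by move=> x; exact: normal_pdf_ge0.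
- exact: measurable_normal_pdf.
Qed.

End gaussian.

Section stein_solution.
Context {R : realType} (h : R -> R).
Hypotheses (ch : continuous h) (h01 : forall x, 0 <= h x <= 1).
Notation mu := (@lebesgue_measure R).
Local Notation phi := (@normal_pdf R 0 1).

Let c : R := \int[gaussian R]_x h x.
Let g x := h x - c.
Let G (x : R) := g x * phi x.

Let mh : measurable_fun setT h. Proof. exact: continuous_measurable_fun. Qed.

Let ih : (gaussian R).-integrable setT (EFin \o h).
Proof.
have : (gaussian R).-integrable setT (EFin \o cst 1) by exact: finite_measure_integrable_cst.
apply: le_integrable => //; first exact/measurable_EFinP.
by move=> x _; rewrite /= lee_fin normr1 ger0_norm; have /andP[] := h01 x.
Qed.

Let c01 : 0 <= c <= 1.
Proof.
apply/andP; split; first by apply: Rintegral_ge0 => x _; have /andP[] := h01 x.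
rewrite (_ : 1 = \int[gaussian R]_x (cst 1 x)); last first.
  by rewrite Rintegral_cst//= [X in fine X](_ : _ = 1%E) ?mul1r//; exact: probability_setT.
apply: le_Rintegral => //; first exact: finite_measure_integrable_cst.
by move=> x _; have /andP[] := h01 x.
Qed.

Let g1 x : `|g x| <= 1.
Proof.
have /andP[? ?] := h01 x; have /andP[? ?] := c01.
by rewrite /g ler_norml; apply/andP; split; lra.
Qed.

Let cg : continuous g.
Proof. by move=> x; apply: cvgB; [exact: ch|exact: cvg_cst]. Qed.

Let cG : continuous G.
Proof. by move=> x; apply: cvgM; [exact: cg|exact: continuous_std_normal_pdf]. Qed.

Let iG (D : set R) : measurable D -> mu.-integrable D (EFin \o G).
Proof.
move=> mD; apply: le_integrable (integrable_std_normal_pdf mD) => //.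
  by apply/measurable_EFinP/measurable_funTS; exact: continuous_measurable_fun.
move=> x _; rewrite /= lee_fin normrM ler_piMl//.
Qed.

Let G0 : \int[mu]_x G x = 0.
Proof.
have ihp : mu.-integrable setT (EFin \o (fun x => h x * phi x)).
  apply: le_integrable (integrable_std_normal_pdf measurableT) => //.
    apply/measurable_EFinP/measurable_funM => //; exact: measurable_normal_pdf.
  move=> x _; rewrite /= lee_fin normrM ler_piMl// ger0_norm; by have /andP[] := h01 x.
rewrite /G /g; under eq_Rintegral do rewrite mulrBl.
have ip := integrable_std_normal_pdf (@measurableT _ (measurableTypeR R)).
rewrite RintegralB//; last by have := integrableZl measurableT c ip; apply: eq_integrable.
rewrite RintegralZl//.
rewrite [X in _ - _ * X](_ : _ = 1); last by rewrite /Rintegral integral_normal_pdf.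
by rewrite mulr1 /c /Rintegral integral_gaussian// subrr.
Qed.

(** The density [phi] is an integrating factor: [f' - x f = g] is equivalent to
    [(f phi)' = g phi = G]. The solution is therefore [H / phi]. *)
Let H x := \int[mu]_(t in `]-oo, x]) G t.

Let dH (x : R) : is_derive x 1 H (G x).
Proof.
have xu : x < x + 1 by rewrite ltrDl.
have [||dHx H'x] := @continuous_FTC1 R G -oo%O x (x + 1) xu (iG (measurable_itv _)).
- exact: ltNyr.
- exact: cG.
by apply: DeriveDef => //; rewrite -derive1E.
Qed.

Let absG_le (D : set R) : measurable D ->
  `|\int[mu]_(t in D) G t| <= \int[mu]_(t in D) phi t.
Proof.
move=> mD; apply: (le_trans (le_normr_Rintegral _ (iG mD))) => //.
apply: le_Rintegral => //.
- by have := integrable_norm (iG mD).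
- exact: integrable_std_normal_pdf.
- by move=> x _; rewrite normrM (ger0_norm (normal_pdf_ge0 _ _ _)) ler_piMl ?normal_pdf_ge0.
Qed.

(** Subtracting the Gaussian mean [c] from [h] gives [G] total integral 0, so the left and right
    tails cancel. *)
Let HE x : H x = - \int[mu]_(t in `[x, +oo[) G t.
Proof.
apply/eqP; rewrite -addr_eq0 -G0 -(setUv `]-oo, x]%classic) eq_sym.
rewrite Rintegral_setU//; last 3 first.
- exact: measurableC.
- by apply: iG; rewrite setUv.
- exact/disj_setPCl.
by rewrite setCitvl Rintegral_itv_obnd_cbnd//; exact: iG.
Qed.

(* Mills' inequality, on the side of x where the tail does not contain 0; this is
   why the two expressions of H are needed. *)
Let H_le x : `|x| * `|H x| <= phi x.
Proof.
have [x0|x0] := leP 0 x.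
  rewrite (ger0_norm x0) HE normrN; apply: le_trans (std_normal_tail_le x0).
  by rewrite ler_wpM2l// absG_le.
rewrite (ltr0_norm x0) -(std_normal_pdfN x).
have Nx0 : 0 <= - x by rewrite oppr_ge0 ltW.
apply: le_trans (std_normal_tail_le Nx0).
by rewrite -std_normal_left_tailE ler_wpM2l// absG_le.
Qed.

(** [H_le] says nothing at [x = 0]; this cruder bound controls the solution near the origin. *)
Let H1 x : `|H x| <= 1.
Proof.
apply: (le_trans (absG_le _)) => //.
rewrite [leRHS](_ : _ = \int[mu]_x phi x); last by rewrite /Rintegral integral_normal_pdf.
have ip := @integrable_std_normal_pdf R.
rewrite Rintegral_mkcond; apply: le_Rintegral => //.
- by rewrite -restrict_EFin -integrable_mkcond//; exact: ip.
- exact: (ip _ measurableT).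
- by move=> t _; rewrite patchE; case: ifP => // _; exact: normal_pdf_ge0.
Qed.

Lemma stein_solution : exists f f' : R -> R, exists C : R,
  [/\ continuous f', forall x : R, is_derive x 1 f (f' x),
      forall x, `|f x| <= C * (1 + `|x|), forall x, `|f' x| <= 2 &
      forall x, f' x - x * f x = h x - \int[gaussian R]_x h x].
Proof.
pose f x := H x / phi x.
have phi0 x : phi x != 0 by rewrite gt_eqF// std_normal_pdf_gt0.
have df (x : R) : is_derive x 1 f (g x + x * f x).
  have dHx := dH x; have dphi := is_derive_std_normal_pdf x.
  have dVphi := is_deriveV (phi0 x) dphi.
  apply: is_derive_eq; rewrite /GRing.scale/= /f /G.
  by have := phi0 x; move: (phi x) => p p0; field.
have cf : continuous f.
  by move=> x; apply/differentiable_continuous/derivable1_diffP; have [] := df x.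
have xf x : `|x * f x| <= 1.
  rewrite /f mulrA normrM normfV normrM (gtr0_norm (std_normal_pdf_gt0 x)).
  by rewrite ler_pdivrMr ?std_normal_pdf_gt0// mul1r.
(* For [|x| >= 1], [|f x| <= |x * f x| <= 1]; for [|x| < 1], [|f x| <= 1 / phi x <= 1 / phi 1]. The
   constant adds the two bounds. *)
exists f, (fun x => g x + x * f x), (1 + (phi 1)^-1); split => //.
- move=> x; apply: cvgD; first exact: cg.
  by apply: cvgM; [exact: cvg_id|exact: cf].
- move=> x; have p0 : 0 <= (phi 1)^-1 by rewrite invr_ge0 normal_pdf_ge0.
  apply: (@le_trans _ _ (1 + (phi 1)^-1)); last by rewrite ler_peMr ?addr_ge0// lerDl.
  have [x1|x1] := leP 1 `|x|.
    apply: (@le_trans _ _ 1); last by rewrite lerDl.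
    by apply: le_trans (xf x); rewrite (normrM x) ler_peMl.
  apply: (@le_trans _ _ (phi 1)^-1); last by rewrite lerDr.
  rewrite /f normrM normfV (gtr0_norm (std_normal_pdf_gt0 x)).
  rewrite -[leRHS]mul1r ler_pM// ?invr_ge0 ?normal_pdf_ge0//.
  rewrite lef_pV2 ?posrE ?std_normal_pdf_gt0//.
  rewrite !std_normal_pdfE ler_wpM2l ?normal_peak_ge0// ler_expR lerN2.
  by rewrite ler_wpM2r// -(real_normK (num_real x)) expr1n expr_le1// ltW.
- move=> x; apply: (le_trans (ler_normD _ _)).
  by rewrite (_ : 2 = 1 + 1)// lerD.
- by move=> x; rewrite addrK.
Qed.
End stein_solution.

(** * Total variation and couplings *)

Lemma bigcup_nondecreasing_approx d (T : measurableType d) (R : realType)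
    (m : {measure set T -> \bar R}) (F : (set T)^nat) (e : R) :
  fin_num_fun m ->
  (forall n, measurable (F n)) -> nondecreasing_seq F -> 0 < e ->
  exists N, (m (\bigcup_n F n `\` F N) <= e%:E)%E.
Proof.
move=> fm mF ndF e0; have mU : measurable (\bigcup_n F n) by exact: bigcup_measurable.
have : (m \o F) n @[n --> \oo] --> (fine (m (\bigcup_n F n)))%:E.
  by rewrite fineK ?fm//; exact: nondecreasing_cvg_mu.
move=> /fine_cvgP[_] /cvgrPdist_le/(_ _ e0)[N _ /(_ N (leqnn N))] h.
exists N; rewrite measureD//; last by rewrite ltey_eq fm.
rewrite setIidr; last by move=> x Fx; exists N.
have fU : m (\bigcup_n F n) \is a fin_num by exact: fm.
have fN : m (F N) \is a fin_num by exact: fm.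
rewrite [leLHS](_ : _ = (fine (m (\bigcup_n F n)) - fine (m (F N)))%:E); last first.
  by rewrite EFinB (fineK fU) (fineK fN).
rewrite lee_fin; apply: le_trans h.
exact: ler_norm.
Qed.

(** * Approximation of Borel sets by continuous functions *)

Section continuous_approx.
Context (R : realType) (m : {measure set (measurableTypeR R) -> \bar R}).
Hypothesis fm : fin_num_fun m.
Implicit Types (A B : set R) (h : R -> R).

(** Measurability is part of the predicate because the closure proofs need it for the sets they
    combine. *)
Let approximable B := measurable B /\ forall e, 0 < e -> exists h,
  [/\ continuous h, forall x, 0 <= h x <= 1 &
      (\int[m]_x `|h x - \1_B x|%:E <= e%:E)%E].

Let mdist h B : continuous h -> measurable B ->
  measurable_fun setT (fun x : measurableTypeR R => `|h x - \1_B x|%:E).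
Proof.
move=> ch mB; apply/measurable_EFinP; apply: measurableT_comp => //.
apply: measurable_funB; first exact: continuous_measurable_fun.
exact: measurable_indic.
Qed.

Let approximableT : approximable setT.
Proof.
split=> // e e0; exists (cst 1); split.
- exact: cst_continuous.
- by move=> x; rewrite /= lexx ler01.
- rewrite integral0_eq ?lee_fin ?ltW// => x _.
  by rewrite indicE mem_setT subrr normr0.
Qed.

(** The positive part of [a - b] takes values in [[0, 1]], and since [B] lies in [A] its pointwise
    error is at most the sum of the errors of [a] and [b]. *)
Let approximableSD : setSD_closed approximable.
Proof.
move=> A B BA [mA aA] [mB aB]; split; first exact: measurableD.
move=> e e0; have e20 : 0 < e / 2 by rewrite divr_gt0.
have [a [ca a01 ae]] := aA _ e20; have [b [cb b01 be]] := aB _ e20.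
have ch : continuous (fun x => Num.max 0 (a x - b x)).
  move=> x; apply: (@continuous_max R R (cst 0) (fun x => a x - b x)).
    exact: cvg_cst.
  by apply: cvgB; [exact: ca|exact: cb].
exists (fun x => Num.max 0 (a x - b x)); split => //.
  move=> x; have /andP[a0 a1] := a01 x; have /andP[b0 b1] := b01 x.
  by rewrite le_max lexx/= ge_max ler01/=; lra.
apply: (@le_trans _ _ (\int[m]_x (`|a x - \1_A x|%:E + `|b x - \1_B x|%:E)))%E.
  apply: ge0_le_integral => //.
  - exact: (mdist ch (measurableD mA mB)).
  - by apply: emeasurable_funD; exact: mdist.
  move=> x _; rewrite -EFinD lee_fin !indicE in_setD.
  have /andP[a0 a1] := a01 x; have /andP[b0 b1] := b01 x.
  case: (boolP (x \in B)) => [/[dup] xB /set_mem/BA/mem_set ->|xB].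
    rewrite /= subr0 (ger0_norm (_ : 0 <= Num.max _ _)) ?le_max ?lexx//.
    rewrite ge_max addr_ge0//= ler0_norm ?subr_le0// ler0_norm ?subr_le0//=; lra.
  rewrite andbT [in leRHS]subr0 [X in _ <= _ + X]ger0_norm//.
  case: (x \in A) => /=; last first.
    rewrite !subr0 (ger0_norm a0) ger0_norm ?le_max ?lexx// ge_max; lra.
  rewrite [X in _ <= X + _]ler0_norm ?subr_le0//.
  rewrite ler_norml; apply/andP; split; last by rewrite lerBlDr ge_max; lra.
  by rewrite lerBrDr le_max; apply/orP; right; lra.
rewrite ge0_integralD//; [|exact: mdist..].
by rewrite [e]splitr EFinD leeD.
Qed.

Let approximable_nd : ndseq_closed approximable.
Proof.
move=> F ndF aF; have mF n : measurable (F n) by have [] := aF n.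
have mU : measurable (\bigcup_n F n) by exact: bigcup_measurable.
split => // e e0; have e20 : 0 < e / 2 by rewrite divr_gt0.
have [N mN] := bigcup_nondecreasing_approx fm mF ndF e20.
have [_ /(_ _ e20)[h [ch h01 he]]] := aF N.
exists h; split => //.
have mD := measurableD mU (mF N).
apply: (@le_trans _ _ (\int[m]_x (`|h x - \1_(F N) x|%:E +
    (\1_(\bigcup_n F n `\` F N) x)%:E)))%E.
  apply: ge0_le_integral => //.
  - exact: mdist.
  - by apply: emeasurable_funD; [exact: mdist|exact/measurable_EFinP/measurable_indic].
  move=> x _; rewrite -EFinD lee_fin !indicE in_setD.
  have /andP[h0 h1] := h01 x.
  case: (boolP (x \in F N)) => [xF|xF].
    by rewrite mem_set ?addr0//; exists N => //; exact/set_mem.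
  case: (x \in _) => /=; last by rewrite addr0.
  by rewrite subr0 ler0_norm ?ger0_norm//; lra.
rewrite ge0_integralD//; last 2 first.
- exact: mdist.
- exact/measurable_EFinP/measurable_indic.
rewrite integral_indic// setIT [e in leRHS]splitr EFinD.
exact: leeD.
Qed.

(** The approximation is a ramp rising from 0 at [x] to 1 at [x + 1/(N + 1)]. It errs only between
    these points, on a set of small mass when [N] is large. *)
Let approximable_ray (x : R) : approximable `]x, +oo[%classic.
Proof.
split => // e e0; pose F n := `[x + n.+1%:R^-1, +oo[%classic : set R.
have ndF : nondecreasing_seq F.
  move=> i j ij; apply/subsetPset => t; rewrite /F/= !in_itv/= !andbT.
  by apply: le_trans; rewrite lerD2l lef_pV2 ?posrE ?ltr0n// ler_nat.
have UF : `]x, +oo[%classic = \bigcup_n F n.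
  apply/seteqP; split => t; rewrite /F/=.
    rewrite in_itv/= andbT -subr_gt0 => xt.
    have [n nt] := ltr_add_invr xt; exists n => //=.
    by rewrite in_itv/= andbT; move: nt; rewrite add0r => /ltW; rewrite lerBrDl.
  by move=> [n _]/=; rewrite !in_itv/= !andbT; apply: lt_le_trans; rewrite ltrDl invr_gt0 ltr0n.
have mF n : measurable (F n) by exact: measurable_itv.
have [N mN] := bigcup_nondecreasing_approx fm mF ndF e0.
pose h (t : R) : R := Num.max 0 (Num.min 1 (N.+1%:R * (t - x))).
have ch : continuous h.
  move=> t; apply: (@continuous_max R R (cst 0)
    (cst 1 \min (fun t => N.+1%:R * (t - x)))); first exact: cvg_cst.
  apply: (@continuous_min R R (cst 1)); first exact: cvg_cst.
  apply: cvgM; first exact: cvg_cst.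
  by apply: cvgB; [exact: cvg_id|exact: cvg_cst].
have h01 t : 0 <= h t <= 1 by rewrite /h le_max lexx/= ge_max ler01/= ge_min lexx.
exists h; split => //.
rewrite UF; apply: le_trans mN.
have mU : measurable (\bigcup_n F n) by exact: bigcup_measurable.
have mD := measurableD mU (mF N).
rewrite -(setIT (_ `\` _)) -integral_indic//.
apply: ge0_le_integral => //.
- exact: mdist.
- exact/measurable_EFinP/measurable_indic.
move=> t _; rewrite lee_fin -UF !indicE in_setD /F.
have /andP[h0 h1] := h01 t.
have -> : (t \in `]x, +oo[%classic) = (x < t).
  by apply/idP/idP; rewrite inE/= in_itv/= andbT.
have -> : (t \in `[x + N.+1%:R^-1, +oo[%classic) = (x + N.+1%:R^-1 <= t).
  by apply/idP/idP; rewrite inE/= in_itv/= andbT.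
case: (ltP x t) => xt /=.
  case: (leP (x + N.+1%:R^-1) t) => xt' /=.
    have -> : h t = 1.
      by rewrite /h min_l ?max_r// -ler_pdivrMl ?ltr0n// mulr1 lerBrDl.
    by rewrite subrr normr0.
  by rewrite ler0_norm ?subr_le0//=; lra.
have -> : h t = 0.
  rewrite /h max_l// ge_min; apply/orP; right; rewrite pmulr_rle0 ?ltr0n//; lra.
by rewrite subr0 normr0.
Qed.

(* The approximable sets form a lambda-system containing the open rays. *)
Lemma continuous_approx B e : measurable B -> 0 < e -> exists h,
  [/\ continuous h, forall x, 0 <= h x <= 1 &
      (\int[m]_x `|h x - \1_B x|%:E <= e%:E)%E].
Proof.
move=> mB e0; suff [_] : approximable B by exact.
have {}mB : (@RGenOInfty.G R).-sigma.-measurable B by rewrite -RGenOInfty.measurableE.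
move: mB; apply: lambda_system_subset => //.
- move=> _ _ [x ->] [y ->]; exists (Num.max x y).
  apply/seteqP; split => t /=; rewrite !in_itv/= !andbT gt_max.
    by move=> [-> ->].
  by move=> /andP.
- by move=> _ [x ->]; exact: approximable_ray.
Qed.
End continuous_approx.

(** Approximating [B] with respect to the sum [mu + nu] provides a single [h] that is close to the
    indicator under both laws. *)
Lemma dist_le_continuous (R : realType) (mu nu : probability (measurableTypeR R) R) (c : R) :
  (forall h : R -> R, continuous h -> (forall x, 0 <= h x <= 1) ->
    `|\int[mu]_x h x - \int[nu]_x h x| <= c) ->
  forall B, measurable B -> `|fine (mu B) - fine (nu B)| <= c.
Proof.
move=> H B mB; apply/ler_addgt0Pr => e e0; have e20 : 0 < e / 2 by rewrite divr_gt0.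
have fmn : fin_num_fun (measure_add mu nu).
  by move=> A mA; rewrite measure_addE fin_numD !fin_num_measure.
have [h [ch h01 he]] := @continuous_approx R (measure_add mu nu) fmn B _ mB e20.
have mh : measurable_fun setT (h : measurableTypeR R -> R) by exact: continuous_measurable_fun.
have mdist : measurable_fun setT (fun x : measurableTypeR R => `|h x - \1_B x|%:E).
  by apply/measurable_EFinP; apply: measurableT_comp => //; apply: measurable_funB.
rewrite ge0_integral_measure_add// in he.
have approx (P : probability (measurableTypeR R) R) :
    (\int[P]_x `|h x - \1_B x|%:E <= (e / 2)%:E)%E ->
    `|fine (P B) - \int[P]_x h x| <= e / 2.
  move=> hP; have iB : P.-integrable setT (EFin \o \1_B).
    by apply: integrable_indic => //; rewrite ltey_eq fin_num_measure.
  have ih : P.-integrable setT (EFin \o h).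
    have : P.-integrable setT (EFin \o cst 1) by exact: finite_measure_integrable_cst.
    apply: le_integrable => //; first exact/measurable_EFinP.
    by move=> x _; rewrite /= lee_fin normr1 ger0_norm; have /andP[] := h01 x.
  have -> : fine (P B) = \int[P]_x \1_B x by rewrite /Rintegral integral_indic// setIT.
  have iBh : P.-integrable setT (EFin \o (fun x => \1_B x - h x)) := integrableB measurableT iB ih.
  rewrite -RintegralB//; apply: (le_trans (le_normr_Rintegral _ iBh)) => //.
  rewrite -lee_fin /Rintegral fineK; last first.
    exact: (integrable_fin_num measurableT (integrable_norm iBh)).
  by under eq_integral do rewrite distrC.
have [h1 h2] : (\int[mu]_x `|h x - \1_B x|%:E <= (e / 2)%:E)%E /\
    (\int[nu]_x `|h x - \1_B x|%:E <= (e / 2)%:E)%E.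
  by split; apply: le_trans he; [apply: leeDl|apply: leeDr]; exact: integral_ge0.
have := H h ch h01; have := approx _ h1; have := approx _ h2.
rewrite !ler_norml => /andP[? ?] /andP[? ?] /andP[? ?].
by apply/andP; split; lra.
Qed.

(** * The maximal coupling *)

Section coupling.
Context (R : realType) (mu nu : probability (measurableTypeR R) R).

Definition signed_difference : {charge set (measurableTypeR R) -> \bar R} :=
  cadd (charge_of_finite_measure mu) (cscale (-1) (charge_of_finite_measure nu)).

Variables (P N : set (measurableTypeR R)).
Hypothesis PN : hahn_decomposition signed_difference P N.

Let mP : measurable P. Proof. by have [[]] := PN. Qed.
Let mN : measurable N. Proof. by have [_ []] := PN. Qed.

Let p := jordan_pos PN.
Let q := jordan_neg PN.

(** The minimum of the two laws: [nu] on [P], where [mu] is the larger, and [mu] on [N]. *)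
Definition overlap : {measure set (measurableTypeR R) -> \bar R} :=
  measure_add (mrestr nu mP) (mrestr mu mN).

Let pE B : measurable B -> p B = (mu (B `&` P) - nu (B `&` P))%E.
Proof.
move=> mB; rewrite /p jordan_posE cjordan_posE /crestr0 mem_set//=.
by rewrite /crestr/= /cadd/= cscaleN1.
Qed.

Let qE B : measurable B -> q B = (nu (B `&` N) - mu (B `&` N))%E.
Proof.
move=> mB; rewrite /q jordan_negE cjordan_negE /crestr0 mem_set//=.
rewrite /crestr/= /cadd/= cscaleN1.
by rewrite fin_num_oppeB ?fin_num_measure//; [rewrite addeC|exact: measurableI].
Qed.

Let splitPN (m : probability (measurableTypeR R) R) B : measurable B ->
  m B = (m (B `&` P) + m (B `&` N))%E.
Proof.
move=> mB; have [_ _ PNT PN0] := PN.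
rewrite -measureU ?setIUr// -?setIUr ?PNT ?setIT//; first exact: measurableI.
- exact: measurableI.
- by rewrite setIACA PN0 setI0.
Qed.

Let fin (m : probability (measurableTypeR R) R) B : measurable B -> m B \is a fin_num.
Proof. exact: fin_num_measure. Qed.

Lemma overlap_jordan_pos B : measurable B -> (overlap B + p B = mu B)%E.
Proof.
move=> mB; rewrite [overlap B]measure_addE /mrestr/= pE// (splitPN mu mB).
have mBP := measurableI _ _ mB mP; have mBN := measurableI _ _ mB mN.
by rewrite addeAC addeCA subee ?adde0 ?fin.
Qed.

Lemma overlap_jordan_neg B : measurable B -> (overlap B + q B = nu B)%E.
Proof.
move=> mB; rewrite [overlap B]measure_addE /mrestr/= qE// (splitPN nu mB).
have mBP := measurableI _ _ mB mP; have mBN := measurableI _ _ mB mN.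
by rewrite -addeA [X in (_ + X)%E]addeCA subee ?adde0 ?fin.
Qed.

(** The common total mass of [p] and [q]. Being a difference of the laws at a single measurable set,
    it inherits any uniform bound on such differences. *)
Definition coupling_gap : R := fine (mu P) - fine (nu P).

Let pT : p setT = coupling_gap%:E.
Proof. by rewrite pE// !setTI /coupling_gap EFinB !fineK// fin_num_measure. Qed.

Let gap0 : 0 <= coupling_gap. Proof. by rewrite -lee_fin -pT. Qed.

Let qT : q setT = coupling_gap%:E.
Proof.
have h (m : probability (measurableTypeR R) R) : fine (m N) = 1 - fine (m P).
  have := splitPN m (@measurableT _ (measurableTypeR R)).
  rewrite probability_setT !setTI => /(congr1 fine); rewrite fineD ?fin//= => ->.
  by rewrite addrC addKr.
rewrite qE// !setTI -(fineK (fin nu mN)) -(fineK (fin mu mN)) -EFinB !h.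
by congr EFin; rewrite /coupling_gap; ring.
Qed.

Let diag (x : measurableTypeR R) : measurableTypeR R * measurableTypeR R := (x, x).

Let mdiag : measurable_fun setT diag.
Proof. exact: measurable_fun_pair. Qed.

Definition diag_overlap : {measure set (measurableTypeR R * measurableTypeR R) -> \bar R}.
Proof.
unshelve refine (pushforward overlap diag : {measure set _ -> \bar R}).
exact: mdiag.
Defined.

Let gapV_ge0 : 0 <= coupling_gap^-1. Proof. by rewrite invr_ge0. Qed.

(* When the gap is 0, p and q vanish on measurable sets and 0^-1 = 0, so that the
   formula still gives a coupling. *)
Definition joint_law : set (measurableTypeR R * measurableTypeR R) -> \bar R :=
  measure_add diag_overlap (mscale (NngNum gapV_ge0) (p \x q)%E).

HB.instance Definition _ := Measure.on joint_law.

Let joint_lawE A : joint_law A =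
  (overlap (diag @^-1` A) + (coupling_gap^-1)%:E * (p \x q) A)%E.
Proof. by rewrite /joint_law measure_addE. Qed.

Let gapK x : (0 <= x <= coupling_gap%:E ->
  (coupling_gap^-1)%:E * (x * coupling_gap%:E) = x)%E.
Proof.
rewrite muleCA -EFinM; have [->|g0] := eqVneq coupling_gap 0.
  by rewrite -eq_le => /eqP <-; rewrite mul0e.
by rewrite mulVf// mule1.
Qed.

Let joint_law_fst B : measurable B -> joint_law (fst @^-1` B) = mu B.
Proof.
move=> mB; rewrite joint_lawE -(overlap_jordan_pos mB); congr (_ + _)%E.
rewrite (_ : fst @^-1` B = B `*` setT); last by apply/seteqP; split => -[x y] // [].
rewrite product_measure1E// [X in (_ * (_ * X))%E]qT gapK// measure_ge0/= -pT.
by rewrite le_measure ?inE.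
Qed.

Let joint_law_snd B : measurable B -> joint_law (snd @^-1` B) = nu B.
Proof.
move=> mB; rewrite joint_lawE -(overlap_jordan_neg mB); congr (_ + _)%E.
rewrite (_ : snd @^-1` B = setT `*` B); last by apply/seteqP; split => -[x y] // [].
rewrite product_measure1E// [X in (_ * (X * _))%E]pT [X in (_ * X)%E]muleC.
rewrite gapK// measure_ge0/= -qT.
by rewrite le_measure ?inE.
Qed.

Let joint_lawT : joint_law setT = 1%E.
Proof. by rewrite -(preimage_setT fst) joint_law_fst// probability_setT. Qed.

HB.instance Definition _ := @Measure_isProbability.Build _ _ R joint_law joint_lawT.

(** The part carried by the diagonal does not charge this set, and the scaled product has total mass
    [coupling_gap]. *)
Lemma joint_law_neq : (joint_law [set z | z.1 <> z.2] <= coupling_gap%:E)%E.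
Proof.
rewrite joint_lawE (_ : diag @^-1` _ = set0); last by apply/seteqP; split => x /=.
rewrite measure0 add0e.
have -> : coupling_gap%:E = ((coupling_gap^-1)%:E * (p \x q) setT)%E.
  rewrite -setXTT product_measure1E//.
  by rewrite [X in (_ * (X * _))%E]pT [X in (_ * (_ * X))%E]qT gapK// lee_fin gap0 lexx.
rewrite lee_wpmul2l ?lee_fin// le_measure ?inE//.
rewrite (_ : [set z | _] = (fun z => (z.1 : R) - z.2) @^-1` (~` [set 0])).
  rewrite -[X in measurable X]setTI.
  by apply: measurable_funB => //; exact: measurableC.
apply/seteqP; split => z /= h; apply: contra_not h.
  by move/eqP; rewrite subr_eq0 => /eqP.
by move=> ->; rewrite subrr.
Qed.

Lemma joint_law_coupling : exists (disp' : measure_display) (S : measurableType disp')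
    (Q : probability S R) (U Z : {RV Q >-> R}),
  [/\ has_law U mu, has_law Z nu &
    (Q [set w | U w <> Z w] <= coupling_gap%:E)%E].
Proof.
have m1 : measurable_fun setT (fst : measurableTypeR R * measurableTypeR R -> R).
  exact: measurable_fst.
have m2 : measurable_fun setT (snd : measurableTypeR R * measurableTypeR R -> R).
  exact: measurable_snd.
pose U : {RV joint_law >-> R} := HB.pack (fst : measurableTypeR R * measurableTypeR R -> R)
  (isMeasurableFun.Build _ _ _ _ _ m1).
pose Z : {RV joint_law >-> R} := HB.pack (snd : measurableTypeR R * measurableTypeR R -> R)
  (isMeasurableFun.Build _ _ _ _ _ m2).
exists _, (measurableTypeR R * measurableTypeR R)%type, joint_law, U, Z; split.
- exact: joint_law_fst.
- exact: joint_law_snd.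
- exact: joint_law_neq.
Qed.
End coupling.

Lemma exists_coupling (R : realType) (mu nu : probability (measurableTypeR R) R) (c : R) :
  (forall B, measurable B -> `|fine (mu B) - fine (nu B)| <= c) ->
  exists (disp' : measure_display) (S : measurableType disp')
    (Q : probability S R) (U Z : {RV Q >-> R}),
  [/\ has_law U mu, has_law Z nu & (Q [set w | U w <> Z w] <= c%:E)%E].
Proof.
move=> h; have [P [N PN]] := Hahn_decomposition (signed_difference mu nu).
have [d [S [Q [U [Z [hU hZ hQ]]]]]] := joint_law_coupling PN.
exists d, S, Q, U, Z; split => //; apply: (le_trans hQ); rewrite lee_fin.
by apply: le_trans (h P _); [exact: ler_norm|have [[]] := PN].
Qed.

(** * Admissible sequences *)

Lemma dist_mu_law_gaussian (R : realType) (d : nat -> nat) (M : nat) :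
  0 < \sum_(i < M) ((d i.+1)%:R : R) ^- 2 -> forall B, measurable B ->
  `|fine (mu_law R d M B) - fine (gaussian R B)| <=
  2 * Num.sqrt (\sum_(i < M) ((d i.+1)%:R ^- 4) / (\sum_(i < M) (d i.+1)%:R ^- 2) ^+ 2).
Proof.
set S := \sum_(i < M) _ => S0.
pose w (i : 'I_M) : R := (d i.+1)%:R^-1 / Num.sqrt S.
have wE y : standardized_sum d y = centred_sum w y.
  rewrite /standardized_sum -/S /centred_sum mulr_suml; apply: eq_bigr => i _.
  by rewrite /w mulrAC.
have sS : Num.sqrt S ^+ 2 = S by rewrite sqr_sqrtr// ltW.
have w2 : \sum_(i < M) w i ^+ 2 = 1.
  have e i : w i ^+ 2 = (d i.+1)%:R ^- 2 / S by rewrite /w exprMn !exprVn sS.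
  by under eq_bigr do rewrite e; rewrite -mulr_suml divff// gt_eqF.
have w4 : \sum_(i < M) w i ^+ 4 = \sum_(i < M) ((d i.+1)%:R ^- 4) / S ^+ 2.
  have e i : w i ^+ 4 = (d i.+1)%:R ^- 4 / S ^+ 2.
    by rewrite /w exprMn !exprVn (exprM (Num.sqrt S) 2 2) sS.
  by under eq_bigr do rewrite e.
rewrite -w4; apply: dist_le_continuous => h ch h01.
have [f [f' [C [cf' df fC f'2 fE]]]] := stein_solution ch h01.
have mh : measurable_fun setT (h : measurableTypeR R -> R) by exact: continuous_measurable_fun.
have ihW : (iid_law (exponential1 R) M).-integrable setT
    (fun y => (h (standardized_sum d y))%:E).
  have : (iid_law (exponential1 R) M).-integrable setT (EFin \o cst 1).
    exact: finite_measure_integrable_cst.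
  apply: le_integrable => //.
    by apply/measurable_EFinP; apply: measurableT_comp => //; exact: measurable_standardized_sum.
  by move=> x _; rewrite /= lee_fin normr1 ger0_norm; have /andP[] := h01 (standardized_sum d x).
have -> : \int[mu_law R d M]_x h x = \int[iid_law (exponential1 R) M]_y h (standardized_sum d y).
  by rewrite /Rintegral /mu_law integral_distribution//; exact/measurable_EFinP.
have := stein_bound cf' df fC f'2 w2.
under eq_integral do rewrite fE -wE EFinB.
rewrite integralB//; last exact: finite_measure_integrable_cst.
rewrite integral_cst// [X in (_ - _ * X)%E](_ : _ = 1%E); last exact: probability_setT.
rewrite mule1 -[X in (`|X - _|)%E]fineK; last exact: (integrable_fin_num measurableT ihW).
by rewrite -EFinB lee_fin.
Qed.

(** It suffices that [expR (9/8) <= 4 <= 2 pi]. The first inequality is the fourth power of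
    [1 - 9/32 <= expR (- 9/32)], since [(23/32)^4 >= 1/4]. *)
Lemma ln_2pi_ge (R : realType) : 9 / 8 <= ln (2 * pi) :> R.
Proof.
rewrite -ler_expR lnK ?posrE ?mulr_gt0 ?pi_gt0//.
apply: (@le_trans _ _ 4); last by have := @pi_ge2 R; lra.
have h := @expR_ge1Dx R (- (9 / 32)).
have : (23 / 32 : R) ^+ 4 <= expR (- (9 / 32)) ^+ 4.
  by apply: lerXn2r; rewrite ?nnegrE ?expR_ge0//; lra.
rewrite -expRM_natl (_ : 4%:R * - (9 / 32) = - (9 / 8)); last by field.
rewrite expRN => {}h.
have e0 := @expR_gt0 R (9 / 8).
rewrite -[leLHS]invrK -[leRHS]invrK lef_pV2 ?posrE ?invr_gt0//.
by apply: le_trans h; lra.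
Qed.

Section admissible.
Context (R : realType) (a : R) (n K : nat) (d : nat -> nat) (M : nat).
Hypotheses (a0 : 0 < a) (hn : (1 <= n)%N) (hK : (1 <= K)%N)
  (hdM : Upsilon a n K (d, M)).

Let S : R := \sum_(i < M) (d i.+1)%:R ^- 2.

Let n0 : 0 < n%:R :> R. Proof. by rewrite ltr0n. Qed.
Let K0 : 0 < K%:R :> R. Proof. by rewrite ltr0n. Qed.

Let M_ge : a * n%:R * K%:R / 2 <= M%:R. Proof. by case: hdM => -[]. Qed.

Let M0 : 0 < M%:R :> R.
Proof. by apply: lt_le_trans M_ge; rewrite divr_gt0// !mulr_gt0. Qed.

Let d_ge (i : 'I_M) : K.+1%:R <= (d i.+1)%:R :> R.
Proof. by case: hdM => _ h _; rewrite ler_nat -addn1 h. Qed.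

Let d0 (i : 'I_M) : 0 < (d i.+1)%:R :> R.
Proof. by apply: lt_le_trans (d_ge i); rewrite ltr0n. Qed.

Let count_ge : a * M%:R / 2 <= \sum_(i < M) (((d i.+1)%:R <= 4 * K%:R / a)%R : nat)%:R.
Proof.
case: hdM => _ _ /le_trans; apply.
rewrite -sum1_count big_mkcond/= natr_sum (iotaDl 1 0) big_map.
rewrite -[X in iota 0 X]subn0 -/(index_iota 0 M) big_mkord.
by apply: ler_sum => i _; rewrite add1n; case: ifP.
Qed.

(** The count in the third condition of [Upsilon] cannot exceed [M]. *)
Lemma admissible_a_le2 : a <= 2.
Proof.
have : a * M%:R / 2 <= M%:R.
  apply: (le_trans count_ge).
  rewrite [leRHS](_ : _ = \sum_(i < M) 1); last by rewrite sumr_const card_ord.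
  by apply: ler_sum => i _; rewrite lern1 leq_b1.
by rewrite mulrAC ger_pMl// => h; lra.
Qed.

(** At least [a M / 2] terms have [d_i <= 4 K / a], each contributing at least [(a / (4 K))^2], and
    [M >= a n K / 2]. *)
Lemma admissible_variance_ge : a ^+ 4 * n%:R / (64 * K%:R) <= S.
Proof.
apply: (@le_trans _ _ ((a * M%:R / 2) * (a / (4 * K%:R)) ^+ 2)).
  have -> : a ^+ 4 * n%:R / (64 * K%:R) =
     a * (a * n%:R * K%:R / 2) / 2 * (a / (4 * K%:R)) ^+ 2.
    by field; rewrite gt_eqF.
  by rewrite ler_wpM2r ?sqr_ge0// ler_wpM2r// ler_wpM2l// ltW.
apply: (le_trans (ler_wpM2r (sqr_ge0 _) count_ge)).
rewrite mulr_suml; apply: ler_sum => i _.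
have [h|h] := leP ((d i.+1)%:R : R) (4 * K%:R / a); last by rewrite mulr0n mul0r invr_ge0 sqr_ge0.
rewrite mulr1n mul1r -exprVn; apply: lerXn2r; rewrite ?nnegrE ?invr_ge0//.
  by rewrite divr_ge0 ?mulr_ge0// ltW.
by rewrite -[leLHS]invf_div lef_pV2 ?posrE// divr_gt0 ?mulr_gt0.
Qed.

Lemma admissible_variance_gt0 : 0 < S.
Proof. by apply: lt_le_trans admissible_variance_ge; rewrite divr_gt0 ?mulr_gt0 ?exprn_gt0. Qed.

Lemma admissible_fourth_moment_le :
  4 * (\sum_(i < M) (d i.+1)%:R ^- 4 / S ^+ 2) <=
  (ln (2 * pi) - 1) * (2 ^+ 15 / (a ^+ 8 * n%:R * (K + 1)%:R)).
Proof.
have S0 := admissible_variance_gt0; have Sge := admissible_variance_ge.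
have K10 : 0 < (K + 1)%:R :> R by rewrite addn1 ltr0n.
have h1 : \sum_(i < M) (d i.+1)%:R ^- 4 / S ^+ 2 <= ((K + 1)%:R ^+ 2 * S)^-1.
  rewrite -mulr_suml.
  have : \sum_(i < M) ((d i.+1)%:R ^- 4 : R) <= (K + 1)%:R ^- 2 * S.
    rewrite mulr_sumr; apply: ler_sum => i _.
    rewrite (exprM _ 2 2) expr2 invfM ler_wpM2r ?invr_ge0 ?sqr_ge0//.
    rewrite lef_pV2 ?posrE ?exprn_gt0// ler_sqr ?nnegrE ?ler0n//.
    by rewrite addn1.
  move=> /(ler_wpM2r (_ : 0 <= S ^- 2)); rewrite invr_ge0 sqr_ge0 => /(_ isT).
  move=> /le_trans; apply; rewrite le_eqVlt; apply/orP; left; apply/eqP.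
  by field; rewrite !gt_eqF.
have h2 : ((K + 1)%:R ^+ 2 * S)^-1 <= 64 / (a ^+ 4 * n%:R * (K + 1)%:R).
  rewrite -[leRHS]invf_div lef_pV2 ?posrE ?divr_gt0 ?mulr_gt0 ?exprn_gt0//.
  apply: le_trans (ler_wpM2l (sqr_ge0 _) Sge).
  rewrite natrD; have -> : (K%:R + 1%:R) ^+ 2 * (a ^+ 4 * n%:R / (64 * K%:R)) =
    (a ^+ 4 * n%:R * (K%:R + 1) / 64) * (1 + K%:R^-1) :> R.
    by field; rewrite gt_eqF.
  by rewrite ler_peMr ?lerDl ?invr_ge0 ?ltW// divr_gt0 ?mulr_gt0 ?exprn_gt0 ?addr_gt0.
apply: (le_trans (ler_wpM2l _ (le_trans h1 h2))) => //.
have a4 : a ^+ 4 <= 16.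
  have := lerXn2r 4 (_ : a \in Num.nneg) (_ : 2 \in Num.nneg) admissible_a_le2.
  by rewrite !nnegrE ltW// => /(_ isT (ler0n _ _)) /le_trans; apply; rewrite -natrX.
have -> : 4 * (64 / (a ^+ 4 * n%:R * (K + 1)%:R)) =
    (256 * a ^+ 4 / 2 ^+ 15) * (2 ^+ 15 / (a ^+ 8 * n%:R * (K + 1)%:R)) :> R.
  by field; rewrite !gt_eqF.
apply: ler_wpM2r.
  by rewrite divr_ge0 ?exprn_ge0// !mulr_ge0 ?exprn_ge0 ?ltW.
by have := @ln_2pi_ge R; lra.
Qed.

End admissible.

Theorem proposition3p1 (R : realType) (n K : nat)
    (hn : (1 <= n)%N) (hK : (1 <= K)%N) (hKn : (K <= n - 1)%N)
    (disp : measure_display) (T : measurableType disp) (P : probability T R)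
    (t : edge -> {RV P >-> R}) (ht : iid_exponential_weights t)
    (a c' : R) (hac : kesten_constants t a c')
    (d : nat -> nat) (M : nat) (hdM : Upsilon a n K (d, M)) :
  dTV (mu_law R d M) (gaussian R) ^+ 2
    <= (ln (2 * pi) - 1) * (2 ^+ 15 / (a ^+ 8 * n%:R * (K + 1)%:R))
  /\
  exists (disp' : measure_display) (S : measurableType disp')
      (Q : probability S R) (U Z : {RV Q >-> R}),
    [/\ has_law U (mu_law R d M), has_law Z (gaussian R) &
      (Q [set w | U w <> Z w]
       <= (Num.sqrt ((ln (2 * pi) - 1) *
                     (2 ^+ 15 / (a ^+ 8 * n%:R * (K + 1)%:R))))%:E)%E].
Proof.
have [a0 _ _] := hac.
have S0 := admissible_variance_gt0 a0 hn hK hdM.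
have key := admissible_fourth_moment_le a0 hn hK hdM.
have dist := dist_mu_law_gaussian S0.
set E := _ * (2 ^+ 15 / _) in key *.
set b := 2 * Num.sqrt _ in dist.
have b0 : 0 <= b by rewrite mulr_ge0 ?sqrtr_ge0.
have bE : b ^+ 2 <= E.
  rewrite exprMn sqr_sqrtr; first by rewrite -natrX.
  by rewrite sumr_ge0// => i _; rewrite divr_ge0 ?sqr_ge0// invr_ge0 exprn_ge0.
split.
  apply: le_trans bE; rewrite ler_sqr ?nnegrE//.
    apply: ge_sup.
      by exists `|fine (mu_law R d M set0) - fine (gaussian R set0)|, set0.
    by move=> _ [B mB <-]; exact: dist.
  (* Comparing squares requires a nonnegative supremum; the empty set provides a nonnegative
     element, and [b] the upper bound that makes [sup] meaningful. *)
  apply: (@le_trans _ _ `|fine (mu_law R d M set0) - fine (gaussian R set0)|) => //.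
  apply: ub_le_sup; last by exists set0.
  by exists b => _ [B mB <-]; exact: dist.
have [disp' [S [Q [U [Z [hU hZ hQ]]]]]] := exists_coupling dist.
exists disp', S, Q, U, Z; split => //; apply: (le_trans hQ).
by rewrite lee_fin -[b]ger0_norm// -sqrtr_sqr ler_wsqrtr.
Qed.
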